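(* Let $(\mathcal W,\mathcal Z)$ be an $\mathcal H\times\widehat{\mathcal H}$-valued random variable (with respect to the product of the Borel $\sigma$-fields), where $\mathcal W$ is the standard Brownian web, such that: (1) for any deterministic $(x,t)\in\mathbb R^2$, there exists a path $\hat\pi^{(x,t)}\in\mathcal Z$ starting at $(x,t)$ and going backward in time almost surely; (2) paths in $\mathcal Z$ do not cross paths in $\mathcal W$ almost surely, that is, there do not exist any $\pi\in\mathcal W$, $\hat\pi\in\mathcal Z$ and $t_1,t_2\in(\sigma_\pi,\sigma_{\hat\pi})$ such that $(\hat\pi(t_1)-\pi(t_1))(\hat\pi(t_2)-\pi(t_2))<0$ almost surely; (3) paths in $\mathcal Z$ and paths in $\mathcal W$ do not coincide over any time interval almost surely, that is, for any $\pi\in\mathcal W$ and $\hat\pi\in\mathcal Z$ and for no pair of points $t_1<t_2$ with $\sigma_\pi\le t_1<t_2\le\sigma_{\hat\pi}$ we have $\hat\pi(t)=\pi(t)$ for all $t\in[t_1,t_2]$ almost surely. Then $\mathcal Z=\widehat{\mathcal W}$ almost surely, where $\widehat{\mathcal W}$ is the dual Brownian web associated with $\mathcal W$.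
   Context: Path spaces. $\mathbb R^2_c$ is the completion of $\mathbb R^2$ under $\rho((x_1,t_1),(x_2,t_2))=|\tanh t_1-\tanh t_2|\vee\bigl|\frac{\tanh x_1}{1+|t_1|}-\frac{\tanh x_2}{1+|t_2|}\bigr|$; it is the image of $[-\infty,\infty]^2$ with $[-\infty,\infty]\times\{\infty\}$ and $[-\infty,\infty]\times\{-\infty\}$ each collapsed to a point, $(\ast,\infty)$ and $(\ast,-\infty)$. $\Pi$ is the set of paths $\pi:[\sigma_\pi,\infty]\to[-\infty,\infty]\cup\{\ast\}$, with starting time $\sigma_\pi\in[-\infty,\infty]$, $\pi(\infty)=\ast$, $\pi(-\infty)=\ast$ if $\sigma_\pi=-\infty$, and $t\mapsto(\pi(t),t)\in(\mathbb R^2_c,\rho)$ continuous, with the complete separable metric $$d_\Pi(\pi_1,\pi_2)=|\tanh\sigma_{\pi_1}-\tanh\sigma_{\pi_2}|\vee\sup_{t\ge\sigma_{\pi_1}\wedge\sigma_{\pi_2}}\Bigl|\tfrac{\tanh\pi_1(t\vee\sigma_{\pi_1})}{1+|t|}-\tfrac{\tanh\pi_2(t\vee\sigma_{\pi_2})}{1+|t|}\Bigr|.$$ $\mathcal H$ is the space of compact subsets of $(\Pi,d_\Pi)$ with the Hausdorff metric and Borel $\sigma$-field. $\widehat\Pi$, $d_{\widehat\Pi}$, $\widehat{\mathcal H}$ are the analogous objects for backward paths $\hat\pi:[-\infty,\sigma_{\hat\pi}]\to[-\infty,\infty]\cup\{\ast\}$ with starting time $\sigma_{\hat\pi}$ (with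 $\hat\pi(-\infty)=\ast$, $\hat\pi(\infty)=\ast$ if $\sigma_{\hat\pi}=\infty$, the supremum in the metric being over $t\le\sigma_{\hat\pi_1}\vee\sigma_{\hat\pi_2}$ and $t\vee\sigma$ replaced by $t\wedge\sigma$). Brownian web and dual. The standard Brownian web $\mathcal W$ is the $\mathcal H$-valued random variable, unique in law, such that: from each deterministic point $z\in\mathbb R^2$ there is a.s. a unique path $\pi_z\in\mathcal W$; for deterministic $z_1,\dots,z_k$ the paths $\pi_{z_1},\dots,\pi_{z_k}$ are coalescing standard Brownian motions (independent until they meet); and for any deterministic countable dense $\mathcal D\subset\mathbb R^2$, $\mathcal W$ is a.s. the closure of $\{\pi_z:z\in\mathcal D\}$. For $\pi^r,\pi^l\in\mathcal W$ with $\pi^r>\pi^l$ at time $\max\{\sigma_{\pi^l},\sigma_{\pi^r}\}$ and coalescing time $T$, the wedge is $A(\pi^r,\pi^l)=\{(y,s):\max\{\sigma_{\pi^l},\sigma_{\pi^r}\}<s<T,\ \pi^l(s)<y<\pi^r(s)\}$. A path $\hat\pi\in\widehat\Pi$ enters a wedge $A$ from outside if there are $\sigma_{\hat\pi}>t_1>t_2$ with $(\hat\pi(t_1),t_1)\notin\overline A$ and $(\hat\pi(t_2),t_2)\in A$. The dual Brownian web $\widehat{\mathcal W}$ is the $\widehat{\mathcal H}$-valued random variable a.s. equal to the set of $\hat\pi\in\widehat\Pi$ that do not enter any wedge of $\mathcal W$ from outside. *)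

(* Defs.v *)
From HB Require Import structures.
From mathcomp Require Import all_boot all_order all_algebra.
From mathcomp Require Import all_classical all_reals all_analysis.
From mathcomp Require Import ring lra.

Set Implicit Arguments.
Unset Strict Implicit.
Unset Printing Implicit Defensive.

Import Order.TTheory GRing.Theory Num.Theory.
Import numFieldNormedType.Exports.

Local Open Scope classical_set_scope.
Local Open Scope ring_scope.

Section Tanh.
Context {R : realType}.

Definition tanh (x : R) : R := (expR x - expR (- x)) / (expR x + expR (- x)).

Definition tanhe (x : \bar R) : R :=
  match x with r%:E => tanh r | +oo%E => 1 | -oo%E => -1 end.

Lemma tanhE x : tanh x = 1 - 2 / (expR (2 * x) + 1).
Proof.
have e0 := expR_gt0 x.
have e1 : expR x ^+ 2 + 1 != 0 by rewrite gt_eqF// ltr_wpDl// sqr_ge0.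
rewrite /tanh expRN.
have -> : expR (2 * x) = expR x ^+ 2 by rewrite -expRM_natl mulr_natl.
by field; rewrite e1 gt_eqF//= expr2.
Qed.

Lemma tanh_lt1 x : tanh x < 1.
Proof. by rewrite tanhE ltrBlDr ltrDl divr_gt0// addr_gt0// expR_gt0. Qed.

Lemma tanh_gtN1 x : -1 < tanh x.
Proof.
have e0 := expR_gt0 (2 * x).
rewrite tanhE ltrBrDl -ltrBrDr opprK ltr_pdivrMr; last by rewrite addr_gt0.
by lra.
Qed.

Lemma tanh_inj : injective tanh.
Proof.
move=> x y; rewrite !tanhE => /addrI/oppr_inj.
have p (z : R) : expR (2 * z) + 1 != 0 by rewrite gt_eqF// addr_gt0// expR_gt0.
move=> /(mulfI _) h; have /h/invr_inj/addIr/expR_inj : (2 : R) != 0 by lra.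
by move=> /(mulfI _) h'; apply: h'; lra.
Qed.

Lemma tanhe_inj : injective tanhe.
Proof.
move=> [x| |] [y| |] //= h.
- by congr (_%:E); exact: tanh_inj.
- by move: (tanh_lt1 x); rewrite h ltxx.
- by move: (tanh_gtN1 x); rewrite h ltxx.
- by move: (tanh_lt1 y); rewrite -h ltxx.
- by exfalso; move: h; lra.
- by move: (tanh_gtN1 y); rewrite -h ltxx.
- by exfalso; move: h; lra.
Qed.

End Tanh.

(* The compactification R^2_c: [-oo, +oo]^2 with [-oo, +oo] * {+oo} and
   [-oo, +oo] * {-oo} collapsed to the points ( *, +oo) and ( *, -oo). *)
Variant R2c (R : realType) : Type :=
  | Pt of \bar R & R
  | Top
  | Bot.
Arguments Top {R}.
Arguments Bot {R}.

Section R2c_metric.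
Context {R : realType}.
Implicit Types p q : R2c R.

Definition R2c_time p : \bar R :=
  match p with Pt _ t => t%:E | Top => +oo%E | Bot => -oo%E end.

(* tanh x / (1 + |t|), which vanishes at t = +oo and t = -oo *)
Definition R2c_space p : R :=
  match p with Pt x t => tanhe x / (1 + `|t|) | Top => 0 | Bot => 0 end.

Definition rho p q : R :=
  Num.max `|tanhe (R2c_time p) - tanhe (R2c_time q)|
          `|R2c_space p - R2c_space q|.

Let rhoxx p : rho p p = 0.
Proof. by rewrite /rho !subrr normr0 maxxx. Qed.

Let rho_positivity p q : rho p q = 0 -> p = q.
Proof.
move=> h.
have : rho p q <= 0 by rewrite h.
rewrite /rho ge_max !normr_le0 !subr_eq0 => /andP[/eqP/tanhe_inj tpq /eqP].
case: p q tpq {h} => [x t| |] [y s| |] //= [->].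
have s0 : (1 + `|s|)^-1 != 0 by rewrite invr_eq0 gt_eqF// ltr_pwDl.
by move=> /(mulIf s0)/tanhe_inj ->.
Qed.

Let rho_sym p q : rho p q = rho q p.
Proof. by rewrite /rho distrC (distrC (R2c_space p)). Qed.

Let rho_triangle q p r : rho p r <= rho p q + rho q r.
Proof.
rewrite /rho ge_max; apply/andP; split.
- by apply: (le_trans (ler_distD (tanhe (R2c_time q)) _ _)); rewrite lerD// le_max lexx.
- by apply: (le_trans (ler_distD (R2c_space q) _ _)); rewrite lerD// le_max lexx orbT.
Qed.

HB.instance Definition _ := gen_eqMixin (R2c R).
HB.instance Definition _ := gen_choiceMixin (R2c R).
HB.instance Definition _ :=
  isMetric.Build R (R2c R) rhoxx rho_positivity rho_sym rho_triangle.

End R2c_metric.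

Variant direction := forward | backward.

Section Paths.
Context {R : realType}.

Definition time_domain (dir : direction) (s : \bar R) : set (\bar R) :=
  match dir with
  | forward => [set t | (s <= t)%E]
  | backward => [set t | (t <= s)%E]
  end.

(* The space-time point (f(t), t); it is ( *, t) for t = +oo and t = -oo. *)
Definition spacetime (f : R -> \bar R) (t : \bar R) : R2c R :=
  match t with r%:E => Pt (f r) r | +oo%E => Top | -oo%E => Bot end.

End Paths.

(* A path takes the value * exactly at the times +oo and -oo of its domain, so
   only its values at real times are stored.  Outside of the domain [pos] is
   normalised to 0, so that equality of paths is Leibniz equality. *)
Record wpath (R : realType) (dir : direction) := WPath {
  start : \bar R;
  pos : R -> \bar R;
  pos_out : forall t : R, ~ time_domain dir start t%:E -> pos t = 0%E;
  wpath_continuous :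
    {within time_domain dir start, continuous (spacetime pos)}
}.

Notation fwd_path R := (wpath R forward).
Notation bwd_path R := (wpath R backward).

Section Path_topology.
Context {R : realType} {dir : direction}.
Implicit Types p q : wpath R dir.

Definition starts_at p (z : R * R) : Prop :=
  start p = z.2%:E /\ pos p z.2 = z.1%:E.

(* tanh of the value at an extended time, with tanh * := 0 *)
Definition tanh_pos p (t : \bar R) : R :=
  if t is r%:E then tanhe (pos p r) else 0.

Definition clamp (t s : \bar R) : \bar R :=
  match dir with forward => maxe t s | backward => mine t s end.

Definition outer_start p q : \bar R :=
  match dir with
  | forward => mine (start p) (start q)
  | backward => maxe (start p) (start q)
  end.

(* The infinite times contribute 0 to the supremum and are left out; the
   supremum of the empty set is 0. *)
Definition path_dist p q : R :=
  Num.max `|tanhe (start p) - tanhe (start q)|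
    (sup [set `| tanh_pos p (clamp t%:E (start p)) / (1 + `|t|)
               - tanh_pos q (clamp t%:E (start q)) / (1 + `|t|) |
         | t in [set t : R | time_domain dir (outer_start p q) t%:E]]).

HB.instance Definition _ := gen_eqMixin (wpath R dir).
HB.instance Definition _ := gen_choiceMixin (wpath R dir).

(* [path_dist] is not exactly a metric: for forward paths constantly equal to
   0, 0 and +oo, started at times M, M ^ 3 and M ^ 2 with M large, the first and
   third are at distance of order 1 / M, while both are at distance of order at
   most 1 / M ^ 2 from the second.  It still generates a metrizable topology,
   of which this is the definition by open sets. *)
Definition path_open (U : set (wpath R dir)) : Prop :=
  forall p, U p -> exists2 e : R, 0 < e & forall q, path_dist p q < e -> U q.

Let path_openT : path_open setT.
Proof. by move=> p _; exists 1. Qed.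

Let path_openI : setI_closed path_open.
Proof.
move=> U V oU oV p [/oU[e e0 He] /oV[f f0 Hf]].
exists (Num.min e f); first by rewrite lt_min e0.
by move=> q; rewrite lt_min => /andP[/He ? /Hf].
Qed.

Let path_open_bigU (I : Type) (f : I -> set (wpath R dir)) :
  (forall i, path_open (f i)) -> path_open (\bigcup_i f i).
Proof.
move=> h p [i _ /h[e e0 He]]; exists e => // q /He; by exists i.
Qed.

HB.instance Definition _ :=
  isOpenTopological.Build (wpath R dir) path_openT path_openI path_open_bigU.

End Path_topology.

Record compacts (R : realType) (dir : direction) := Compacts {
  compact_set :> set (wpath R dir);
  compact_setP : compact compact_set
}.

Section Hausdorff.
Context {R : realType} {dir : direction}.
Implicit Types K L : compacts R dir.

Local Open Scope ereal_scope.

(* The empty set is at distance +oo from every nonempty compact set. *)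
Definition hausdorff_dist K L : \bar R :=
  maxe (ereal_sup [set ereal_inf [set (path_dist p q)%:E | q in compact_set L]
                  | p in compact_set K])
       (ereal_sup [set ereal_inf [set (path_dist p q)%:E | p in compact_set K]
                  | q in compact_set L]).

HB.instance Definition _ := gen_eqMixin (compacts R dir).
HB.instance Definition _ := gen_choiceMixin (compacts R dir).
HB.instance Definition _ :=
  isPointed.Build (compacts R dir) (Compacts (@compact0 (wpath R dir))).

Definition hausdorff_open (U : set (compacts R dir)) : Prop :=
  forall K, U K ->
    exists2 e : R, (0 < e)%R & forall L, hausdorff_dist K L < e%:E -> U L.

Let hausdorff_openT : hausdorff_open setT.
Proof. by move=> K _; exists 1%R. Qed.

Let hausdorff_openI : setI_closed hausdorff_open.
Proof.
move=> U V oU oV K [/oU[e e0 He] /oV[f f0 Hf]].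
exists (Num.min e f); first by rewrite lt_min e0.
by move=> L; rewrite EFin_min lt_min => /andP[/He ? /Hf].
Qed.

Let hausdorff_open_bigU (I : Type) (f : I -> set (compacts R dir)) :
  (forall i, hausdorff_open (f i)) -> hausdorff_open (\bigcup_i f i).
Proof.
move=> h K [i _ /h[e e0 He]]; exists e => // L /He; by exists i.
Qed.

HB.instance Definition _ := isOpenTopological.Build (compacts R dir)
  hausdorff_openT hausdorff_openI hausdorff_open_bigU.

End Hausdorff.

(* [compacts R dir] with its Borel sigma-algebra *)
Notation borel_compacts R dir :=
  (g_sigma_algebraType (@open (compacts R dir))).
Notation Hspace R := (borel_compacts R forward).
Notation Hhat R := (borel_compacts R backward).

Section Brownian_motions.
Context {R : realType} {d : measure_display} {T : measurableType d}.
Variable P : probability T R.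

(* Standard Brownian motion started from the space-time point z = (x, t) *)
Definition brownian_motion (z : R * R) (B : R -> T -> R) : Prop :=
  [/\ forall w, B z.2 w = z.1,
      forall w, {within [set t : R | z.2 <= t], continuous (B^~ w)},
      forall t, z.2 <= t -> measurable_fun setT (B t),
      forall (s t : R) (A : set R), z.2 <= s -> s < t -> measurable A ->
        P [set w | A (B t w - B s w)] = normal_prob 0 (Num.sqrt (t - s)) A &
      forall (n : nat) (t : nat -> R) (A : nat -> set R),
        z.2 <= t 0%N -> (forall i, t i <= t i.+1) ->
        (forall i, measurable (A i)) ->
        P (\bigcap_(i in [set: 'I_n]) [set w | A i (B (t i.+1) w - B (t i) w)])
        = (\prod_(i < n) fine (P [set w | A i (B (t i.+1) w - B (t i) w)]))%:E].

Definition independent_processes (k : nat) (z : 'I_k -> R * R)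
    (B : 'I_k -> R -> T -> R) : Prop :=
  forall (m : nat) (t : 'I_k -> 'I_m -> R) (A : 'I_k -> 'I_m -> set R),
    (forall i j, (z i).2 <= t i j) -> (forall i j, measurable (A i j)) ->
    P (\bigcap_(i in [set: 'I_k]) \bigcap_(j in [set: 'I_m])
         [set w | A i j (B i (t i j) w)])
    = (\prod_(i < k) fine (P (\bigcap_(j in [set: 'I_m])
         [set w | A i j (B i (t i j) w)])))%:E.

End Brownian_motions.

Section Coalescing.
Context {R : realType}.

(* The paths [b i], [i < k], started at the times [(z i).2], determine
   coalescing paths [c i]: [c i] follows [b i] up to the first time at which it
   meets some [c j] with [j < i], and follows [c j] from then on. *)
Definition meets (k : nat) (z : 'I_k -> R * R) (b c : 'I_k -> R -> R)
    (i j : 'I_k) (s : R) : Prop :=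
  [/\ (j < i)%N, (z i).2 <= s, (z j).2 <= s & c j s = b i s].

Definition coalescing_paths (k : nat) (z : 'I_k -> R * R)
    (b c : 'I_k -> R -> R) : Prop :=
  forall (i : 'I_k) (t : R), (z i).2 <= t ->
    ((forall j s, s <= t -> ~ meets z b c i j s) -> c i t = b i t) /\
    (forall j s, s <= t -> meets z b c i j s ->
       (forall j' s', s' < s -> ~ meets z b c i j' s') -> c i t = c j t).

(* Equality in law (of finite-dimensional distributions) with the coalescing
   paths of independent Brownian motions; the latter may live on another
   probability space. *)
Definition coalescing_brownian_motions (d : measure_display)
    (T : measurableType d) (P : probability T R) (k : nat) (z : 'I_k -> R * R)
    (X : 'I_k -> R -> T -> R) : Prop :=
  (forall i t, (z i).2 <= t -> measurable_fun setT (X i t)) /\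
  exists (d' : measure_display) (T' : measurableType d')
    (P' : probability T' R) (B C : 'I_k -> R -> T' -> R),
  [/\ forall i, brownian_motion P' (z i) (B i),
      independent_processes P' z B,
      forall w, coalescing_paths z (fun i t => B i t w) (fun i t => C i t w),
      forall i t, (z i).2 <= t -> measurable_fun setT (C i t) &
      forall (m : nat) (i : 'I_m -> 'I_k) (t : 'I_m -> R) (A : 'I_m -> set R),
        (forall l, (z (i l)).2 <= t l) -> (forall l, measurable (A l)) ->
        P (\bigcap_(l in [set: 'I_m]) [set w | A l (X (i l) (t l) w)])
        = P' (\bigcap_(l in [set: 'I_m]) [set w | A l (C (i l) (t l) w)])].

End Coalescing.

Section Webs.
Context {R : realType} {d : measure_display} {T : measurableType d}.
Variable P : probability T R.

(* The paths of the web started from z_1, ..., z_k are a.s. unique, and [X] is a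
   version of this family of paths. *)
Definition brownian_web (W : T -> Hspace R) : Prop :=
  [/\ measurable_fun setT W,
      forall z : R * R,
        {ae P, forall w, exists! p, compact_set (W w) p /\ starts_at p z},
      forall (k : nat) (z : 'I_k -> R * R),
        exists X : 'I_k -> R -> T -> R,
          coalescing_brownian_motions P z X /\
          {ae P, forall w, forall i p, compact_set (W w) p ->
             starts_at p (z i) ->
             forall t, (z i).2 <= t -> pos p t = (X i t w)%:E} &
      forall D : set (R * R), countable D -> dense D ->
        {ae P, forall w, compact_set (W w) =
           closure [set p | compact_set (W w) p /\
                            exists2 z, D z & starts_at p z]}].

Local Open Scope ereal_scope.

Definition last_start (pl pr : fwd_path R) : \bar R := maxe (start pl) (start pr).

(* pl < pr at the later of the two starting times; when that time is infinite
   both paths are at * there and are not ordered *)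
Definition initially_ordered (pl pr : fwd_path R) : Prop :=
  exists2 t : R, last_start pl pr = t%:E & pos pl t < pos pr t.

Definition coalescing_time (pl pr : fwd_path R) : \bar R :=
  ereal_inf [set t%:E | t in
    [set t : R | last_start pl pr < t%:E /\ pos pl t = pos pr t]].

Definition wedge (pl pr : fwd_path R) : set (R2c R) :=
  [set x | exists (y : \bar R) (s : R),
    [/\ x = Pt y s, last_start pl pr < s%:E,
        s%:E < coalescing_time pl pr, pos pl s < y & y < pos pr s]].

Definition enters_from_outside (q : bwd_path R) (A : set (R2c R)) : Prop :=
  exists t1 t2 : R,
    [/\ t1%:E < start q, (t2 < t1)%R,
        ~ closure A (spacetime (pos q) t1%:E) &
        A (spacetime (pos q) t2%:E)].

Definition avoids_wedges (K : set (fwd_path R)) : set (bwd_path R) :=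
  [set q | forall pl pr, K pl -> K pr -> initially_ordered pl pr ->
             ~ enters_from_outside q (wedge pl pr)].

Definition dual_brownian_web (W : T -> Hspace R) (What : T -> Hhat R) : Prop :=
  measurable_fun setT What /\
  {ae P, forall w, compact_set (What w) = avoids_wedges (compact_set (W w))}.

End Webs.

Section Interaction.
Context {R : realType}.
Implicit Types (p : fwd_path R) (q : bwd_path R).
Local Open Scope ereal_scope.

(* [x +? y] excludes the undefined differences of equal infinite values. *)
Definition crosses p q : Prop :=
  exists t1 t2 : R,
    [/\ start p < t1%:E < start q, start p < t2%:E < start q,
        pos q t1 +? - pos p t1, pos q t2 +? - pos p t2 &
        (pos q t1 - pos p t1) * (pos q t2 - pos p t2) < 0].

(* Only coincidence in R^2 is meant: a Brownian web contains paths that are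
   constantly +oo or constantly -oo, and so does its dual. *)
Definition coincide_on_interval p q : Prop :=
  exists t1 t2 : R,
    [/\ start p <= t1%:E, (t1 < t2)%R, t2%:E <= start q &
        forall t : R, (t1 <= t <= t2)%R ->
          pos q t = pos p t /\ pos p t \is a fin_num].

End Interaction.

(* Main.v *)
(* Once a null set is discarded, the theorem is deterministic.  Besides the
   assumptions on Z, two properties of the web are used: paths from rational
   points coalesce when they meet, and a path of Z from a rational point (y, v)
   does not pass, at an earlier rational time u, through a path of W that started
   at a rational point before u.  For the second property, q(u) lies between a
   and b essentially when the paths of W from (a, u) and (b, u) pass y on
   different sides at time v, and this is independent of the position of the
   older path at time u, whose law has a bounded density.

   Z is contained in the dual: if q in Z enters a wedge of W, paths of W from
   rational points on both sides of q, inside the wedge, must keep q between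
   them, hence coincide with q after they have met.

   The dual is contained in Z: a path q of the dual crosses neither the paths of
   W nor those of Z from rational points.  At a rational time u before its start
   it is bounded by limits in Z of paths started to its left and to its right.
   If such a limit differed from q, then a path of W would pass between the two
   and meet q at time u; by the second property it would then coincide with q
   from u on.  Since the bounds of q in Z cannot follow it, there are paths of W on
   both sides of q that coalesce on q, and q enters the wedge that they form.
   So q agrees with a path of Z up to u, and u tends to the start of q. *)
Require Import Defs.
From HB Require Import structures.
From mathcomp Require Import all_boot all_order all_algebra.
From mathcomp Require Import all_classical all_reals all_analysis.
From mathcomp Require Import ring lra.

Set Implicit Arguments.
Unset Strict Implicit.
Unset Printing Implicit Defensive.

Import Order.TTheory GRing.Theory Num.Theory.
Import numFieldNormedType.Exports.

Local Open Scope classical_set_scope.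
Local Open Scope ring_scope.

(** * The topology of paths *)

Section Order.
Context {R : realType}.
Local Open Scope ereal_scope.

Lemma tanh_mono : {mono @tanh R : x y / (x < y)%R}.
Proof.
apply: leW_mono; apply: le_mono => x y xy.
rewrite !tanhE ltrD2l ltrN2 ltr_pM2l ?ltr0n// ltf_pV2 ?posrE ?addr_gt0 ?expR_gt0//.
by rewrite ltrD2r ltr_expR ltr_pM2l ?ltr0n.
Qed.

Lemma tanhe_lt (x y : \bar R) : (tanhe x < tanhe y)%R = (x < y).
Proof.
have h1 := @tanh_lt1 R; have hN1 := @tanh_gtN1 R.
case: x y => [x| |] [y| |] /=; rewrite ?lte_fin ?tanh_mono ?ltxx ?ltry ?ltNyr ?h1 ?hN1//.
- by rewrite lt_gtF ?hN1.
- by rewrite lt_gtF ?h1.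
- by rewrite lt_gtF//; lra.
- by apply/idP; rewrite -subr_gt0 opprK addr_gt0.
Qed.

Lemma rat_between (x y : \bar R) : x < y -> exists r : rat, x < (ratr r)%:E < y.
Proof.
case: x y => [x| |] [y| |] //=.
- by rewrite lte_fin => /rat_in_itvoo[r /itvP hr]; exists r; rewrite !lte_fin !hr.
- move=> _; have /rat_in_itvoo[r /itvP hr] : (x < x + 1)%R by lra.
  by exists r; rewrite lte_fin ltry hr.
- move=> _; have /rat_in_itvoo[r /itvP hr] : (y - 1 < y)%R by lra.
  by exists r; rewrite lte_fin ltNyr hr.
- by move=> _; exists 0%R; rewrite ltry ltNyr.
Qed.

(* The real coordinate in which [rho] compares the positions x and y at the
   common time t. *)
Definition scaled (x : \bar R) (t : R) : R := (tanhe x / (1 + `|t|))%R.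

Lemma scaled_lt (x y : \bar R) (t : R) : (scaled x t < scaled y t)%R = (x < y).
Proof. by rewrite ltr_pM2r ?tanhe_lt// invr_gt0 ltr_pwDl. Qed.

Lemma scaled_inj (t : R) : injective (scaled ^~ t).
Proof.
move=> x y /= h.
by case: (ltgtP x y) => //; rewrite -(scaled_lt _ _ t) h ltxx.
Qed.

End Order.

(** * Epsilon-delta form of continuity on a set *)

Section ContinuousOn.
Context {R : realType}.
Implicit Types (f g : R -> R) (D : set R).

Lemma within_continuousP D f :
  {within D, continuous f} <->
  forall c, D c -> forall e, 0 < e -> exists2 e', 0 < e' &
    forall t, D t -> `|t - c| < e' -> `|f t - f c| < e.
Proof.
split=> [/subspace_continuousP cf c Dc e e0|cf].
  have /cvgrPdist_lt/(_ e e0) := cf c Dc.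
  rewrite near_withinE => /nbhs_ballP[r /= r0 hr].
  exists r => // t Dt tc; rewrite distrC; apply: hr => //.
  by rewrite /ball/= distrC.
apply/subspace_continuousP => c Dc; apply/cvgrPdist_lt => e e0.
have [r r0 hr] := cf c Dc e e0.
rewrite near_withinE; apply/nbhs_ballP; exists r => //= t.
by rewrite /ball/= distrC => tc Dt; rewrite distrC; exact: hr.
Qed.

Lemma within_lt_nbhs D f g c :
  {within D, continuous f} -> {within D, continuous g} -> D c -> f c < g c ->
  exists2 e, 0 < e & forall t, D t -> `|t - c| < e -> f t < g t.
Proof.
move=> /within_continuousP cf /within_continuousP cg Dc fgc.
have e0 : 0 < (g c - f c) / 2 by lra.
have [r r0 hr] := cf c Dc _ e0; have [s s0 hs] := cg c Dc _ e0.
exists (Num.min r s); first by rewrite lt_min r0.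
move=> t Dt; rewrite lt_min => /andP[/(hr t Dt) + /(hs t Dt)].
by rewrite !ltr_norml => /andP[? ?] /andP[? ?]; lra.
Qed.

End ContinuousOn.

(** * Scaled positions and open sets of paths *)

Section PathTopology.
Context {R : realType} {dir : direction}.
Implicit Types p q : wpath R dir.
Local Open Scope ereal_scope.

Definition scaled_pos p (t : R) : R := scaled (pos p t) t.

(** The difference of scaled positions is one of the two terms of [rho]. Through this coordinate,
    paths with infinite values are handled as continuous real functions. *)
Lemma scaled_pos_continuous p :
  {within [set t | time_domain dir (start p) t%:E], continuous (scaled_pos p)}.
Proof.
apply/within_continuousP => c Dc e e0.
have /subspace_continuousP/(_ c%:E Dc)/cvg_ballP/(_ e e0) := wpath_continuous (w := p).
rewrite near_withinE => /nbhs_EFin/nbhs_ballP[r /= r0 hr].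
exists r => // t Dt tc.
have : ball c r t by rewrite /ball /= distrC.
move=> /hr/(_ Dt); rewrite /ball/= /mdist/= /rho /= gt_max => /andP[_].
by rewrite distrC.
Qed.

(** [clamp] is the identity at times of both domains, so each scaled difference there is a term of
    the supremum. Below, [path_dist] is used only through these bounds. *)
Lemma path_dist_bounds p q (e : R) : (path_dist p q < e)%R ->
  (`|tanhe (start p) - tanhe (start q)| < e)%R /\
  forall t : R, time_domain dir (start p) t%:E -> time_domain dir (start q) t%:E ->
    (`|scaled_pos p t - scaled_pos q t| < e)%R.
Proof.
rewrite /path_dist gt_max => /andP[-> /= hs]; split=> // t tp tq.
apply: le_lt_trans hs; apply: ub_le_sup.
  have tb (r : wpath R dir) (s : \bar R) : (`|tanh_pos r s| <= 1)%R.
    case: s => [s| |] /=; rewrite ?normr0//.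
    rewrite ler_norml; case: (pos r s) => [x| |]/=.
    - by rewrite !ltW// ?tanh_lt1// tanh_gtN1.
    - by lra.
    - by lra.
  (* Each quotient has modulus at most 1; a bound is required because [sup] takes a default value on
     unbounded sets. *)
  exists 2%R => _ [s _ <-]; apply: (le_trans (ler_normB _ _)).
  by rewrite -[leRHS]/(1 + 1)%R lerD// normrM mulr_ile1 ?normr_ge0 ?tb// normfV
    ger0_norm ?addr_ge0// invf_le1 ?lerDl// ltr_pwDl.
have cl s : time_domain dir s t%:E -> clamp (dir := dir) t%:E s = t%:E.
  by rewrite /clamp; case: (dir) => /=; [move/max_idPl|move/min_idPl].
exists t => /=; last by rewrite !cl.
rewrite /outer_start; move: (start p) (start q) tp => sp sq.
case: (dir) => /= h; first by rewrite ge_min h.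
by rewrite le_max h.
Qed.

Lemma open_start_lt (s : \bar R) : open [set p : wpath R dir | start p < s].
Proof.
move=> p /=; rewrite -tanhe_lt => h; exists (tanhe s - tanhe (start p))%R.
  by rewrite subr_gt0.
move=> q /path_dist_bounds[+ _]; rewrite -tanhe_lt ltr_norml.
by move=> /andP[? ?]; lra.
Qed.

Lemma open_start_gt (s : \bar R) : open [set p : wpath R dir | s < start p].
Proof.
move=> p /=; rewrite -tanhe_lt => h; exists (tanhe (start p) - tanhe s)%R.
  by rewrite subr_gt0.
move=> q /path_dist_bounds[+ _]; rewrite -tanhe_lt ltr_norml.
by move=> /andP[? ?]; lra.
Qed.

End PathTopology.

Section PathTopology2.
Context {R : realType}.
Implicit Type dir : direction.
Local Open Scope ereal_scope.

(** The strict form of [time_domain] is an open condition on the path, so paths close to a given one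
    are still defined at such a time. *)
Definition inner_time dir (s t : \bar R) : Prop :=
  match dir with forward => s < t | backward => t < s end.

Lemma inner_time_domain dir s t : inner_time dir s t -> time_domain dir s t.
Proof. by case: dir => /= /ltW. Qed.

Lemma open_inner_time dir (t : \bar R) :
  open [set p : wpath R dir | inner_time dir (start p) t].
Proof. case: dir; [exact: open_start_lt|exact: open_start_gt]. Qed.

(** With its mirror image and the conditions on the starting time, this provides the open sets
    through which inequalities pass to limits of paths. *)
Lemma open_pos_gt dir (x : \bar R) (t : R) :
  open [set p : wpath R dir | inner_time dir (start p) t%:E /\ x < pos p t].
Proof.
move=> p [tp xp]; have [e e0 he] := open_inner_time tp.
rewrite -(scaled_lt _ _ t) in xp.
exists (Num.min e (scaled_pos p t - scaled x t)%R); first by rewrite lt_min e0 subr_gt0.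
move=> q; rewrite lt_min => /andP[/he tq /path_dist_bounds[_ /(_ t)]].
move=> /(_ (inner_time_domain tp) (inner_time_domain tq)) h; split=> //=.
rewrite -(scaled_lt _ _ t); move: h xp; rewrite /scaled_pos ltr_norml.
by move=> /andP[? ?] ?; lra.
Qed.

Lemma open_pos_lt dir (x : \bar R) (t : R) :
  open [set p : wpath R dir | inner_time dir (start p) t%:E /\ pos p t < x].
Proof.
move=> p [tp xp]; have [e e0 he] := open_inner_time tp.
rewrite -(scaled_lt _ _ t) in xp.
exists (Num.min e (scaled x t - scaled_pos p t)%R); first by rewrite lt_min e0 subr_gt0.
move=> q; rewrite lt_min => /andP[/he tq /path_dist_bounds[_ /(_ t)]].
move=> /(_ (inner_time_domain tp) (inner_time_domain tq)) h; split=> //=.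
rewrite -(scaled_lt _ _ t); move: h xp; rewrite /scaled_pos ltr_norml.
by move=> /andP[? ?] ?; lra.
Qed.

(** A cluster point of the sequence; infinitely many terms in each open neighbourhood replace the
    extraction of a subsequence. *)
Lemma compact_limit_point dir (K : set (wpath R dir)) (u : nat -> wpath R dir) :
  compact K -> (forall n, K (u n)) -> exists2 p, K p & forall U : set (wpath R dir), open U -> U p ->
    forall N : nat, exists2 n, (N <= n)%N & U (u n).
Proof.
move=> cK Ku; have [|p [Kp cp]] := cK (u @ \oo) _.
  by exists 0%N => // n _; exact: Ku.
exists p => // U oU Up N.
have [|_ [[n /= Nn <-] Uu]] := cp (u @` [set n | N <= n]%N) U _ (open_nbhs_nbhs (conj oU Up)).
  by exists N => // n /= Nn; exists n.
by exists n.
Qed.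

End PathTopology2.

Section BackwardPaths.
Context {R : realType}.
Implicit Types q : bwd_path R.
Local Open Scope ereal_scope.

(** At the starting time the position is the limit of earlier ones, and later it is normalised to 0;
    the proofs stored in the record are irrelevant. *)
Lemma bwd_path_eq q q' : start q = start q' ->
  (forall t : R, t%:E < start q -> pos q t = pos q' t) -> q = q'.
Proof.
move=> es ep.
have {}ep : pos q = pos q'.
  apply/funext => t; case: (ltgtP t%:E (start q)) => [/ep//|ht|ht].
    by rewrite !pos_out//= -?es; apply/negP; rewrite -ltNge.
  apply: (@scaled_inj _ t); apply/eqP; rewrite eq_le.
  have nlt (r r' : bwd_path R) : start r = t%:E -> start r' = t%:E ->
      (forall s : R, s%:E < t%:E -> pos r s = pos r' s) ->
      (scaled_pos r t <= scaled_pos r' t)%R.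
    move=> sr sr' err'; rewrite leNgt; apply/negP => lt_rr'.
    have := scaled_pos_continuous (p := r); have := scaled_pos_continuous (p := r').
    rewrite /= sr sr' => cr' cr.
    have [//|e e0 he] := within_lt_nbhs cr' cr _ lt_rr'; first by rewrite /= lexx.
    have : (scaled_pos r' (t - e / 2) < scaled_pos r (t - e / 2))%R.
      apply: he => /=; first by rewrite lee_fin; lra.
      by rewrite addrAC subrr add0r normrN ger0_norm; lra.
    by rewrite /scaled_pos err' ?ltxx// lte_fin; lra.
  by rewrite -/(scaled_pos q t) -/(scaled_pos q' t) !nlt// -?es// => s; rewrite ht => /ep.
case: q q' es ep => [s f out cf] [s' f' out' cf'] /= es ef.
by subst s' f'; congr WPath; exact: Prop_irrelevance.
Qed.

End BackwardPaths.

(** * Approximation in the extended line and dense strict inequalities *)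

Section RealTools.
Context {R : realType}.

Lemma scaled_continuous (x : \bar R) : continuous (scaled x).
Proof.
move=> t; apply: cvgM; first exact: cvg_cst.
apply: cvgV; first by rewrite gt_eqF// ltr_pwDl.
by apply: cvgD; [exact: cvg_cst|apply: cvg_norm].
Qed.

(** [rho] measures time through [tanh]; strict monotonicity turns closeness of the values of [tanh]
    back into closeness of the arguments. *)
Lemma tanh_nbhs (t e : R) : 0 < e ->
  exists2 e', 0 < e' & forall s, `|tanh t - tanh s| < e' -> `|s - t| < e.
Proof.
move=> e0.
have h1 : tanh t < tanh (t + e) by rewrite tanh_mono ltrDl.
have h2 : tanh (t - e) < tanh t by rewrite tanh_mono gtrBl.
exists (Num.min (tanh (t + e) - tanh t) (tanh t - tanh (t - e))).
  by rewrite lt_min !subr_gt0 h1.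
move=> s; rewrite lt_min !ltr_norml => /andP[/andP[h3 h4] /andP[h5 h6]].
have : s < t + e by rewrite -tanh_mono; lra.
have : t - e < s by rewrite -tanh_mono; lra.
by rewrite ltrBlDr ltrBlDl ltrBrDr => ? ?; apply/andP; lra.
Qed.

(** [x - 1 / (n + 1)] or, for [x] infinite, [n] approaches [x] from below, and a rational is taken
    between this and [x]. Convergence is put in terms of order so that it makes sense at [+oo]. *)
Lemma ereal_approx_left (x : \bar R) : (-oo < x)%E ->
  exists2 y : nat -> rat, forall n, ((ratr (y n))%:E < x)%E &
    forall z, (z < x)%E -> exists N, forall n, (N <= n)%N -> (z < (ratr (y n))%:E)%E.
Proof.
move=> x0; have [w wx hw] : exists2 w : nat -> \bar R, forall n, (w n < x)%E &
    forall z, (z < x)%E -> exists N, forall n, (N <= n)%N -> (z <= w n)%E.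
  case: x x0 => [x| |]// _.
    exists (fun n => (x - n.+1%:R^-1)%:E).
      by move=> n; rewrite lte_fin gtrBl invr_gt0.
    case=> [z| |]//; last by exists 0%N => n _; rewrite leNye.
    rewrite lte_fin => zx; exists (Num.bound (x - z)^-1) => n Nn.
    rewrite lee_fin lerBrDl -lerBrDr -[leRHS]invrK lef_pV2 ?posrE ?invr_gt0 ?subr_gt0//.
    apply/ltW; apply: lt_le_trans (archi_boundP _) _.
      by rewrite invr_ge0 subr_ge0 ltW.
    by rewrite ler_nat leqW.
  exists (fun n => n%:R%:E); first by move=> n; rewrite ltry.
  case=> [z| |]//; last by exists 0%N => n _; rewrite leNye.
  move=> _; exists (Num.bound `|z|) => n Nn; rewrite lee_fin.
  apply: (le_trans (ler_norm z)); apply/ltW.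
  by apply: lt_le_trans (archi_boundP _) _; rewrite ?normr_ge0// ler_nat.
have [y hy] := choice (fun n => rat_between (wx n)).
exists y; first by move=> n; have /andP[] := hy n.
move=> z /hw[N hN]; exists N => n /hN h; apply: le_lt_trans h _.
by have /andP[] := hy n.
Qed.

Lemma ereal_approx_right (x : \bar R) : (x < +oo)%E ->
  exists2 y : nat -> rat, forall n, (x < (ratr (y n))%:E)%E &
    forall z, (x < z)%E -> exists N, forall n, (N <= n)%N -> ((ratr (y n))%:E < z)%E.
Proof.
move=> x0; have [|y yx hy] := @ereal_approx_left (- x)%E; first by case: (x) x0 => [x1| |]; rewrite ?ltNyr.
exists (fun n => - y n) => [n|z xz].
  by rewrite rmorphN EFinN lteNr; exact: yx.
have [|N hN] := hy (- z)%E; first by rewrite lteN2.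
by exists N => n /hN; rewrite rmorphN EFinN lteNl.
Qed.

(** By continuity each strict inequality holds on an open set of times, dense by assumption, and two
    dense open sets share a rational time. *)
Lemma dense_lt_pair (f g f' g' : R -> R) (a b : R) : a < b ->
  let I := [set t | a <= t <= b] in
  {within I, continuous f} -> {within I, continuous g} ->
  {within I, continuous f'} -> {within I, continuous g'} ->
  (forall c d, a <= c -> c < d -> d <= b -> exists2 t, c <= t <= d & f t < g t) ->
  (forall c d, a <= c -> c < d -> d <= b -> exists2 t, c <= t <= d & f' t < g' t) ->
  exists r : rat, [/\ a < ratr r < b, f (ratr r) < g (ratr r) & f' (ratr r) < g' (ratr r)].
Proof.
move=> ab I cf cg cf' cg' hfg hfg'.
(* The interval found may leave [[c, d]], but by less than [d - c] on either side. *)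
have shrink (h h' : R -> R) c d : {within I, continuous h} -> {within I, continuous h'} ->
    a < c -> c < d -> d < b -> (exists2 t, c <= t <= d & h t < h' t) ->
    exists c' d', [/\ a < c', c' < d', d' < b, c - (d - c) < c' & d' < d + (d - c)] /\
      forall t, c' <= t <= d' -> h t < h' t.
  move=> ch ch' ac cd db [t tcd htt'].
  have [|e e0 he] := within_lt_nbhs ch ch' _ htt'; first by rewrite /I /=; lra.
  pose k := Num.min e (Num.min (Num.min (c - a) (b - d)) (d - c)) / 2.
  have k0 : 0 < k by rewrite divr_gt0// !lt_min e0 !subr_gt0 ac db cd.
  have [k1 k2 k3 k4] : [/\ k < e, k < c - a, k < b - d & k < d - c].
    have m0 : 0 < Num.min e (Num.min (Num.min (c - a) (b - d)) (d - c)).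
      by rewrite !lt_min e0 !subr_gt0 ac db cd.
    have : k < Num.min e (Num.min (Num.min (c - a) (b - d)) (d - c)) by rewrite /k; lra.
    by rewrite !lt_min => /and3P[? /andP[? ?] ?]; split.
  exists (t - k), (t + k); split; first by split; lra.
  move=> s st; apply: he; first by rewrite /I/=; lra.
  by rewrite ltr_norml; lra.
have [|||t tab ft] := hfg (a + (b - a) / 3) (b - (b - a) / 3); try lra.
have [||||||c [d [[ac cd db _ _] hcd]]] := shrink f g (a + (b - a) / 3) (b - (b - a) / 3);
  try by []; try lra.
  by exists t.
(* For the middle third of [[c, d]] this excess is below a third of [d - c], so the second interval
   stays inside the first. *)
have [|||t' tcd ft'] := hfg' (c + (d - c) / 3) (d - (d - c) / 3); try lra.
have [||||||c' [d' [[ac' cd' db' h1 h2] hcd']]] :=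
    shrink f' g' (c + (d - c) / 3) (d - (d - c) / 3); try by []; try lra.
  by exists t'.
have /rat_in_itvoo[r /itvP hr] := cd'.
have hr1 : c' < ratr r by rewrite hr.
have hr2 : ratr r < d' by rewrite hr.
by exists r; split; [lra| apply: hcd; lra| apply: hcd'; lra].
Qed.

End RealTools.

(** * Order, meeting and crossing of paths *)

Section PathOrder.
Context {R : realType}.
Local Open Scope ereal_scope.

Lemma scaled_pos_continuousW dir (p : wpath R dir) (D : set R) :
  (forall t, D t -> time_domain dir (start p) t%:E) -> {within D, continuous (scaled_pos p)}.
Proof. by move=> h; apply: continuous_subspaceW (scaled_pos_continuous (p := p)). Qed.

Lemma pos_lt_nbhs dir dir' (p : wpath R dir) (q : wpath R dir') (c : R) :
  time_domain dir (start p) c%:E -> time_domain dir' (start q) c%:E -> pos p c < pos q c ->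
  exists2 e : R, (0 < e)%R & forall t : R, time_domain dir (start p) t%:E ->
    time_domain dir' (start q) t%:E -> (`|t - c| < e)%R -> pos p t < pos q t.
Proof.
move=> pc qc; rewrite -(scaled_lt _ _ c) => h.
pose D := [set t : R | time_domain dir (start p) t%:E /\ time_domain dir' (start q) t%:E].
have [|||e e0 he] := @within_lt_nbhs _ D (scaled_pos p) (scaled_pos q) c _ _ _ h.
- by apply: scaled_pos_continuousW => t [].
- by apply: scaled_pos_continuousW => t [].
- by [].
by exists e => // t tp tq /(he t (conj tp tq)); rewrite scaled_lt.
Qed.

(** The intermediate value theorem for the difference of scaled positions, which is real even where
    positions are infinite. *)
Lemma pos_meet dir dir' (p : wpath R dir) (q : wpath R dir') (a b : R) : (a <= b)%R ->
  (forall t : R, (a <= t <= b)%R ->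
    time_domain dir (start p) t%:E /\ time_domain dir' (start q) t%:E) ->
  pos p a <= pos q a -> pos q b <= pos p b ->
  exists2 c : R, (a <= c <= b)%R & pos p c = pos q c.
Proof.
move=> ab dom; rewrite leNgt -(scaled_lt _ _ a) -leNgt => ha.
rewrite leNgt -(scaled_lt _ _ b) -leNgt => hb.
pose f t := (scaled_pos q t - scaled_pos p t)%R.
have cf : {within `[a, b], continuous f}.
  move=> t; apply: cvgB; apply: scaled_pos_continuousW => {}t /=;
    by rewrite in_itv/= => /dom[].
have [|c /[!in_itv]/= abc fc0] := IVT (v := 0%R) ab cf.
  by rewrite ge_min le_max /f !subr_ge0 !subr_le0 ha hb orbT.
exists c => //; apply: (@scaled_inj _ c) => /=; apply/esym/eqP.
by rewrite -subr_eq0; apply/eqP.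
Qed.

(** Phrased through order alone, hence meaningful at infinite positions, and including both starting
    times, where the positions of paths from rational points are prescribed. *)
Definition no_cross (p : fwd_path R) (q : bwd_path R) : Prop :=
  forall t1 t2 : R, (t1 < t2)%R -> start p <= t1%:E -> t2%:E <= start q ->
    (pos p t1 < pos q t1 -> pos p t2 <= pos q t2) /\
    (pos q t1 < pos p t1 -> pos q t2 <= pos p t2).

(** Strict inequalities survive small shifts, so both times can be moved strictly inside the
    domains. *)
Lemma no_cross_open (p : fwd_path R) (q : bwd_path R) :
  (forall t1 t2 : R, (t1 < t2)%R -> start p < t1%:E -> t2%:E < start q ->
    ~ (pos p t1 < pos q t1 /\ pos q t2 < pos p t2) /\
    ~ (pos q t1 < pos p t1 /\ pos p t2 < pos q t2)) ->
  no_cross p q.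
Proof.
move=> h t1 t2 t12 pt1 qt2.
have pt2 : start p <= t2%:E by rewrite (le_trans pt1)// lee_fin ltW.
have qt1 : t1%:E <= start q by rewrite (le_trans _ qt2)// lee_fin ltW.
have shift (e1 e2 : R) : (0 < e1)%R -> (0 < e2)%R -> exists s1 s2 : R,
    [/\ (s1 < s2)%R, start p < s1%:E, s2%:E < start q,
        (`|s1 - t1| < e1)%R & (`|s2 - t2| < e2)%R].
  move=> e10 e20; pose k := (Num.min (Num.min e1 e2) (t2 - t1) / 3)%R.
  have m0 : (0 < Num.min (Num.min e1 e2) (t2 - t1))%R by rewrite !lt_min e10 e20 subr_gt0.
  have k0 : (0 < k)%R by rewrite divr_gt0.
  have : (k * 3 <= Num.min (Num.min e1 e2) (t2 - t1))%R by rewrite /k; lra.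
  rewrite !le_min => /andP[/andP[? ?] ?].
  exists (t1 + k)%R, (t2 - k)%R; split.
  - lra.
  - by apply: le_lt_trans pt1 _; rewrite lte_fin; lra.
  - by apply: lt_le_trans qt2; rewrite lte_fin; lra.
  - by rewrite addrAC subrr add0r gtr0_norm//; lra.
  - by rewrite addrAC subrr add0r normrN gtr0_norm//; lra.
split=> h1; rewrite leNgt; apply/negP => h2.
- have [//|//|e1 e10 he1] := pos_lt_nbhs _ _ h1.
  have [//|//|e2 e20 he2] := pos_lt_nbhs _ _ h2.
  have [s1 [s2 [s12 ps1 qs2 d1 d2]]] := shift _ _ e10 e20.
  have [+ _] := h _ _ s12 ps1 qs2; apply; split.
  + by apply: he1 => //=; [exact: ltW|rewrite (le_trans _ (ltW qs2))// lee_fin ltW].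
  + by apply: he2 => //=; [exact: ltW|rewrite (le_trans (ltW ps1))// lee_fin ltW].
- have [//|//|e1 e10 he1] := pos_lt_nbhs _ _ h1.
  have [//|//|e2 e20 he2] := pos_lt_nbhs _ _ h2.
  have [s1 [s2 [s12 ps1 qs2 d1 d2]]] := shift _ _ e10 e20.
  have [_ +] := h _ _ s12 ps1 qs2; apply; split.
  + by apply: he1 => //=; [rewrite (le_trans _ (ltW qs2))// lee_fin ltW|exact: ltW].
  + by apply: he2 => //=; [rewrite (le_trans (ltW ps1))// lee_fin ltW|exact: ltW].
Qed.

(** Strictly ordered extended reals have a well-defined difference of the expected sign, so the
    guards [+?] in [crosses] hold whenever the order is reversed. *)
Lemma no_crossP (p : fwd_path R) (q : bwd_path R) : ~ crosses p q -> no_cross p q.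
Proof.
move=> ncr; apply: no_cross_open => t1 t2 t12 pt1 qt2.
have pt2 : start p < t2%:E by rewrite (lt_trans pt1).
have qt1 : t1%:E < start q by rewrite (lt_trans _ qt2).
have defB (x y : \bar R) : x < y -> [/\ y +? - x, x +? - y & x - y < 0].
  case: x y => [x| |] [y| |]//= xy; split=> //; rewrite ?ltNyr//.
  by rewrite -EFinB lte_fin subr_lt0.
split=> -[h1 h2]; apply: ncr; exists t1, t2; have [d1 d1' n1] := defB _ _ h1;
  have [d2 d2' n2] := defB _ _ h2; split=> //; rewrite ?pt1 ?pt2//.
- by rewrite mule_gt0_lt0 ?sube_gt0.
- by rewrite mule_lt0_gt0 ?sube_gt0.
Qed.

End PathOrder.

(** * The dual web, given the almost sure properties *)

Section GoodWebs.
Context {R : realType}.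
Local Open Scope ereal_scope.

Definition from_rat dir (p : wpath R dir) : Prop :=
  exists a s : rat, starts_at p (ratr a, ratr s).

(* Almost sure properties of a Brownian web K and of a set Zs of backward paths
   as in the theorem; they suffice for Zs to be the dual of K. *)
Record good_web (K : set (fwd_path R)) : Prop := GoodWeb {
  web_path : forall a s : rat, exists2 p, K p & starts_at p (ratr a, ratr s);
  web_fin : forall p, K p -> from_rat p -> forall t : R, start p <= t%:E ->
    pos p t \is a fin_num;
  web_closure : K `<=` closure [set p | K p /\ from_rat p];
  web_coalesce : forall p p', K p -> K p' -> from_rat p -> from_rat p' ->
    forall t1 t2 : R, (t1 <= t2)%R -> start p <= t1%:E -> start p' <= t1%:E ->
    pos p t1 = pos p' t1 -> pos p t2 = pos p' t2
}.

Record good_dual (K : set (fwd_path R)) (Zs : set (bwd_path R)) : Prop := GoodDual {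
  dual_compact : compact Zs;
  dual_path : forall y u : rat, exists2 q, Zs q & starts_at q (ratr y, ratr u);
  dual_no_cross : forall p q, K p -> Zs q -> no_cross p q;
  dual_no_coincide : forall p q, K p -> Zs q -> ~ coincide_on_interval p q;
  dual_no_touch : forall p q (a s y v u : rat), K p -> Zs q ->
    starts_at p (ratr a, ratr s) -> starts_at q (ratr y, ratr v) ->
    (s < u < v)%R -> pos q (ratr u) <> pos p (ratr u)
}.

Variables (K : set (fwd_path R)) (Zs : set (bwd_path R)).
Hypothesis gK : good_web K.
Hypothesis gZ : good_dual K Zs.
Implicit Types (p : fwd_path R) (q : bwd_path R).

Lemma skeleton_path (a s : rat) : exists p, [/\ K p, from_rat p,
  start p = (ratr s)%:E & pos p (ratr s) = (ratr a)%:E].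
Proof. by have [p Kp [/= sp pp]] := web_path gK a s; exists p; split=> //; exists a, s. Qed.

Lemma dual_skeleton_path (y u : rat) : exists q, [/\ Zs q,
  starts_at q (ratr y, ratr u),
  start q = (ratr u)%:E & pos q (ratr u) = (ratr y)%:E].
Proof. by have [q Zq [/= sq qq]] := dual_path gZ y u; exists q; split. Qed.

(** Two such paths can change order only by meeting, and they coalesce where they meet. *)
Lemma skeleton_order p p' (t1 t2 : R) : K p -> K p' -> from_rat p -> from_rat p' ->
  (t1 <= t2)%R -> start p <= t1%:E -> start p' <= t1%:E ->
  pos p t1 <= pos p' t1 -> pos p t2 <= pos p' t2.
Proof.
move=> Kp Kp' rp rp' t12 pt1 p't1 h1; rewrite leNgt; apply/negP => h2.
have [t /andP[tt1 tt2]|c /andP[tc ct] epp'] := pos_meet t12 _ h1 (ltW h2).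
  by split=> /=; [rewrite (le_trans pt1)|rewrite (le_trans p't1)].
have := web_coalesce gK Kp Kp' rp rp' ct _ _ epp'.
rewrite (le_trans pt1)// (le_trans p't1)// => /(_ erefl erefl) e.
by rewrite e ltxx in h2.
Qed.

(** [p] is a limit of paths from rational points, and a strict order at [t1] followed by the reverse
    at [t2] is an open condition on [p], as [p] starts strictly before [t1]. *)
Lemma web_order p p' (t1 t2 : R) : K p -> K p' -> from_rat p' -> (t1 <= t2)%R ->
  start p < t1%:E -> start p' <= t1%:E ->
  (pos p t1 < pos p' t1 -> pos p t2 <= pos p' t2) /\
  (pos p' t1 < pos p t1 -> pos p' t2 <= pos p t2).
Proof.
move=> Kp Kp' rp' t12 pt1 p't1.
have pt2 : start p < t2%:E by rewrite (lt_le_trans pt1).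
split=> h1; rewrite leNgt; apply/negP => h2.
  have [|r [[Kr rr] [[/= rt1 hr1] [/= rt2 hr2]]]] := web_closure gK Kp
    (open_nbhs_nbhs (conj (openI (@open_pos_lt _ forward (pos p' t1) t1)
                                 (@open_pos_gt _ forward (pos p' t2) t2)) _)).
    by [].
  by move: hr2; rewrite ltNge (skeleton_order Kr Kp' rr rp' t12)// ltW.
have [|r [[Kr rr] [[/= rt1 hr1] [/= rt2 hr2]]]] := web_closure gK Kp
  (open_nbhs_nbhs (conj (openI (@open_pos_gt _ forward (pos p' t1) t1)
                               (@open_pos_lt _ forward (pos p' t2) t2)) _)).
  by [].
by move: hr2; rewrite ltNge (skeleton_order Kp' Kr rp' rr t12)// ltW.
Qed.

(** This has the form that [dense_lt_pair] takes as hypothesis; [web_fin] ensures that equality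
    throughout would be coincidence in the plane. *)
Lemma no_coincide_lt p q (c d : R) : K p -> Zs q -> from_rat p ->
  start p <= c%:E -> (c < d)%R -> d%:E <= start q ->
  (forall t : R, (c <= t <= d)%R -> pos p t <= pos q t) ->
  exists2 t : R, (c <= t <= d)%R & pos p t < pos q t.
Proof.
move=> Kp Zq rp pc cd dq h; apply: contrapT => no.
apply: (dual_no_coincide gZ Kp Zq); exists c, d; split=> // t tcd; split.
  apply/eqP; rewrite eq_le h// andbT leNgt; apply/negP => lt_pq.
  by apply: no; exists t.
by apply: (web_fin gK) => //; rewrite (le_trans pc)// lee_fin; case/andP: tcd.
Qed.

Lemma no_coincide_gt p q (c d : R) : K p -> Zs q -> from_rat p ->
  start p <= c%:E -> (c < d)%R -> d%:E <= start q ->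
  (forall t : R, (c <= t <= d)%R -> pos q t <= pos p t) ->
  exists2 t : R, (c <= t <= d)%R & pos q t < pos p t.
Proof.
move=> Kp Zq rp pc cd dq h; apply: contrapT => no.
apply: (dual_no_coincide gZ Kp Zq); exists c, d; split=> // t tcd; split.
  apply/eqP; rewrite eq_le h//= leNgt; apply/negP => lt_pq.
  by apply: no; exists t.
by apply: (web_fin gK) => //; rewrite (le_trans pc)// lee_fin; case/andP: tcd.
Qed.

(** Paths [p] and [p'] from rational points of the wedge at time [tau] satisfy
    [pl <= p <= q <= p' <= pr] from then up to the start of [q]. So [q] could leave the wedge only
    through its end, after which [p] and [p'] have merged around [q]. *)
Lemma dual_avoids_wedges : Zs `<=` avoids_wedges K.
Proof.
move=> q Zq pl pr Kl Kr _ [t1 [t2 [qt1 t21 ncl]]].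
move=> [y [s [[<- es] ls sT ly yr]]]; subst s; rename y into y0.
have lt2 : start pl < t2%:E by rewrite (le_lt_trans _ ls)// le_max lexx.
have rt2 : start pr < t2%:E by rewrite (le_lt_trans _ ls)// le_max lexx orbT.
have qt2 : t2%:E < start q by rewrite (lt_trans _ qt1)// lte_fin.
have [/=||el el0 hel] := pos_lt_nbhs _ _ ly; [exact: ltW|exact: ltW|].
have [/=||er er0 her] := pos_lt_nbhs _ _ yr; [exact: ltW|exact: ltW|].
pose c := coalescing_time pl pr.
(* [tau] is so soon after [t2] that [q] is still strictly between the sides, and it precedes [t1]
   and the coalescing time. *)
have [tau] : exists tau : rat, t2%:E < (ratr tau)%:E <
    mine (mine (t2 + el)%:E (t2 + er)%:E) (mine t1%:E c).
  by apply: rat_between; rewrite !lt_min !lte_fin !ltrDl el0 er0 t21.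
rewrite !lt_min !lte_fin => /and3P[t2tau /andP[taul taur] /andP[tau1 tauc]].
have ltau : start pl < (ratr tau)%:E by rewrite (lt_trans lt2).
have rtau : start pr < (ratr tau)%:E by rewrite (lt_trans rt2).
have qtau : (ratr tau)%:E < start q by rewrite (lt_trans _ qt1).
have tau_t2 : (`|ratr tau - t2| = ratr tau - t2 :> R)%R by rewrite gtr0_norm ?subr_gt0.
have [b /andP[b1 b2]] : exists b : rat, pos pl (ratr tau) < (ratr b)%:E < pos q (ratr tau).
  by apply: rat_between; apply: hel => /=; [exact: ltW|exact: ltW|rewrite tau_t2; lra].
have [b' /andP[b'1 b'2]] : exists b : rat, pos q (ratr tau) < (ratr b)%:E < pos pr (ratr tau).
  by apply: rat_between; apply: her => /=; [exact: ltW|exact: ltW|rewrite tau_t2; lra].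
have [p [Kp rp sp pp]] := skeleton_path b tau.
have [p' [Kp' rp' sp' pp']] := skeleton_path b' tau.
have plp (t : R) : (ratr tau <= t)%R -> pos pl t <= pos p t.
  by move=> tt; have [|+ _] := web_order Kl Kp rp tt ltau; rewrite ?sp ?pp//; exact.
have p'pr (t : R) : (ratr tau <= t)%R -> pos p' t <= pos pr t.
  by move=> tt; have [|_] := web_order Kr Kp' rp' tt rtau; rewrite ?sp' ?pp'//; exact.
have pq (t : R) : (ratr tau < t)%R -> t%:E <= start q -> pos p t <= pos q t.
  by move=> tt qt; have [] := dual_no_cross gZ Kp Zq tt _ qt; rewrite ?sp ?pp// => /(_ b2).
have qp' (t : R) : (ratr tau < t)%R -> t%:E <= start q -> pos q t <= pos p' t.
  by move=> tt qt; have [] := dual_no_cross gZ Kp' Zq tt _ qt; rewrite ?sp' ?pp'// => _ /(_ b'1).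
have [B nB AB] : exists2 B : set (R2c R), nbhs (spacetime (pos q) t1%:E) B &
    forall x, wedge pl pr x -> ~ B x.
  apply: contrapT => no; apply: ncl => B nB; apply: contrapT => AB.
  by apply: no; exists B => // x Ax Bx; apply: AB; exists x.
have /subspace_continuousP/(_ t1%:E (ltW qt1)) cq := wpath_continuous (w := q).
have : \forall t \near within (time_domain backward (start q)) (nbhs t1%:E),
    B (spacetime (pos q) t) by exact: cq.
rewrite near_withinE => /nbhs_EFin/nbhs_ballP[e /= e0 he].
(* From [t1] to [d] the path [q] stays in [B], which misses the wedge; if the wedge lasts beyond
   [t1], it also lasts beyond [d]. *)
have [d] : exists d : rat, t1%:E < (ratr d)%:E <
    mine (mine (start q) (t1 + e)%:E) (if t1%:E < c then c else +oo).
  apply: rat_between; rewrite !lt_min !lte_fin !ltrDl e0 qt1/=.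
  by case: ifP => //; rewrite ltry.
rewrite !lt_min !lte_fin => /and3P[t1d /andP[dq de] dc].
have dom (t : R) : (t1 <= t <= ratr d)%R -> (ratr tau < t)%R /\ t%:E <= start q.
  move=> /andP[? ?]; split; first by lra.
  by rewrite (le_trans _ (ltW dq)).
have domp (t : R) : (t1 <= t <= ratr d)%R -> start p <= t%:E.
  by move=> /dom[]; rewrite sp lee_fin => /ltW.
have domp' (t : R) : (t1 <= t <= ratr d)%R -> start p' <= t%:E.
  by move=> /dom[]; rewrite sp' lee_fin => /ltW.
(* Non-coincidence makes both inequalities strict at a common rational time [r]. *)
have [||||u v uu uv vv|u v uu uv vv|r [/andP[t1r rd] pr1 pr2]] := @dense_lt_pair _ (scaled_pos p) (scaled_pos q)
    (scaled_pos q) (scaled_pos p') _ _ t1d.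
- by apply: scaled_pos_continuousW => t /domp.
- by apply: scaled_pos_continuousW => t /dom[].
- by apply: scaled_pos_continuousW => t /dom[].
- by apply: scaled_pos_continuousW => t /domp'.
- have [||t uvt|t tuv ht] := no_coincide_lt Kp Zq rp _ uv.
  + by apply: domp; lra.
  + by apply: (dom _ _).2; lra.
  + by apply: pq; apply dom; lra.
  + by exists t => //; rewrite scaled_lt.
- have [||t uvt|t tuv ht] := no_coincide_gt Kp' Zq rp' _ uv.
  + by apply: domp'; lra.
  + by apply: (dom _ _).2; lra.
  + by apply: qp'; apply dom; lra.
  + by exists t => //; rewrite scaled_lt.
rewrite !scaled_lt in pr1 pr2.
have [taur' _] : (ratr tau < ratr r :> R)%R /\ (ratr r)%:E <= start q by apply: dom; lra.
(* If the sides meet at some [s < r], they squeeze [p] and [p'] together at [s], so these agree at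
   [r], where [q] is strictly between them. *)
have [cr|rc] := ltP c (ratr r)%:E.
  have [_ [s [ls' ss] <-] sr] := ereal_inf_lt cr.
  have cs : c <= s%:E by apply: ereal_inf_lbound; exists s.
  have taus : (ratr tau < s)%R by rewrite -lte_fin (lt_le_trans tauc).
  have e1 : pos p s = pos p' s.
    apply/eqP; rewrite eq_le; apply/andP; split.
      apply: (@skeleton_order _ _ (ratr tau)) => //; rewrite ?sp ?sp' ?pp ?pp' ?(ltW taus)//.
      by rewrite ltW// (lt_trans b2).
    by rewrite (le_trans (p'pr _ (ltW taus)))// -ss plp// ltW.
  have := web_coalesce gK Kp Kp' rp rp' (ltW sr) _ _ e1.
  rewrite sp sp' !lee_fin (ltW taus) => /(_ erefl erefl) e2.
  by move: (lt_trans pr1 pr2); rewrite e2 ltxx.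
(* Otherwise [q] is in the wedge at time [r], and also in [B]. *)
apply: (AB (Pt (pos q (ratr r)) (ratr r))).
  exists (pos q (ratr r)), (ratr r); split => //.
  - by rewrite (lt_trans ls)// lte_fin; lra.
  - case: ifP dc => [t1c dc|/negbT]; first by rewrite (lt_trans _ dc).
    by rewrite -leNgt => ct1; move: (le_trans rc ct1); rewrite lee_fin leNgt t1r.
  - by rewrite (le_lt_trans _ pr1)// plp// ltW.
  - by rewrite (lt_le_trans pr2)// p'pr// ltW.
apply: he => /=; last by rewrite (le_trans _ (ltW dq))// lee_fin ltW.
by rewrite /ball/= ltr_norml; lra.
Qed.

(** [q] is inside the wedge just after [tau], and each alternative keeps [q] at time [t1] out of the
    closure: the first two by position, the third because the wedge is over before [t1]. *)
Lemma wedge_entered q pl pr (tau t1 : R) : avoids_wedges K q -> K pl -> K pr ->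
  last_start pl pr = tau%:E -> (tau < t1)%R -> t1%:E < start q ->
  pos pl tau < pos q tau -> pos q tau < pos pr tau ->
  ~ [\/ pos q t1 < pos pl t1, pos pr t1 < pos q t1 |
      exists2 s : R, (tau < s < t1)%R & pos pl s = pos pr s].
Proof.
move=> aq Kl Kr etau tau1 qt1 lq qr out.
have ltau : start pl <= tau%:E by rewrite -etau le_max lexx.
have rtau : start pr <= tau%:E by rewrite -etau le_max lexx orbT.
have qtau : tau%:E <= start q by rewrite (le_trans _ (ltW qt1))// lee_fin ltW.
have [//|//|el el0 hel] := pos_lt_nbhs _ _ lq.
have [//|//|er er0 her] := pos_lt_nbhs _ _ qr.
pose e := (Num.min (Num.min el er) (t1 - tau))%R.
have e0 : (0 < e)%R by rewrite !lt_min el0 er0 subr_gt0.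
have [eel eer et] : [/\ e <= el, e <= er & e <= t1 - tau]%R.
  have : (e <= e)%R by [].
  by rewrite {2}/e !le_min => /andP[/andP[? ?] ?].
have inw (t : R) : (tau < t < tau + e)%R -> pos pl t < pos q t /\ pos q t < pos pr t.
  move=> /andP[taut te].
  have lt : start pl <= t%:E by rewrite (le_trans ltau)// lee_fin ltW.
  have rt : start pr <= t%:E by rewrite (le_trans rtau)// lee_fin ltW.
  have qt : t%:E <= start q by rewrite (le_trans _ (ltW qt1))// lee_fin; lra.
  have tt : (`|t - tau| = t - tau)%R by rewrite gtr0_norm ?subr_gt0.
  by split; [apply: hel|apply: her] => //; rewrite tt; lra.
have io : initially_ordered pl pr by exists tau => //; exact: lt_trans qr.
apply: (aq pl pr Kl Kr io); exists t1, (tau + e / 2)%R; split=> //.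
- by lra.
- move=> cl; have near_t1 (r : R) : (0 < r)%R -> exists y (s : R),
      [/\ tau%:E < s%:E, s%:E < coalescing_time pl pr, pos pl s < y, y < pos pr s &
          (`|tanh t1 - tanh s| < r)%R /\ (`|scaled_pos q t1 - scaled y s| < r)%R].
    move=> r0; have [_ [[y [s [-> + sT ly yr]]] ]] := cl _ (nbhsx_ballx _ _ r0).
    rewrite etau => taus; rewrite /ball/= /mdist/= /rho /= gt_max => /andP[? ?].
    by exists y, s.
  (* Continuity of a path with time measured by [tanh], as in [rho]. *)
  have close dir (p : wpath R dir) (k : R) : time_domain dir (start p) t1%:E -> (0 < k)%R ->
      exists2 r : R, (0 < r)%R & forall s : R, time_domain dir (start p) s%:E ->
        (`|tanh t1 - tanh s| < r)%R -> (`|scaled_pos p s - scaled_pos p t1| < k)%R.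
    move=> pt1 k0.
    have [r r0 hr] := (within_continuousP _ _).1 (scaled_pos_continuous (p := p)) t1 pt1 k k0.
    have [r' r'0 hr'] := tanh_nbhs t1 r0.
    by exists r' => // s ps /hr'/(hr s ps).
  have lt1 : start pl <= t1%:E by rewrite (le_trans ltau)// lee_fin ltW.
  have rt1 : start pr <= t1%:E by rewrite (le_trans rtau)// lee_fin ltW.
  case: out => [|| [s /andP[taus s1] ss]].
  + rewrite -(scaled_lt _ _ t1) -/(scaled_pos _ _) -/(scaled_pos _ _) => lt_ql.
    have k0 : (0 < (scaled_pos pl t1 - scaled_pos q t1) / 2)%R by lra.
    have [r r0 hr] := close forward pl _ lt1 k0.
    have [|y [s [taus _ + _ []]]] := near_t1 (Num.min r ((scaled_pos pl t1 - scaled_pos q t1) / 2))%R.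
      by rewrite lt_min r0.
    rewrite -(scaled_lt _ _ s) -/(scaled_pos _ _) !lt_min => ly /andP[/hr + _] /andP[_].
    rewrite /= (le_trans ltau) ?(ltW taus)// => /(_ erefl).
    rewrite !ltr_norml => /andP[? ?] /andP[? ?].
    by have : (0 < 0 :> R)%R by [lra]; rewrite ltxx.
  + rewrite -(scaled_lt _ _ t1) -/(scaled_pos _ _) -/(scaled_pos _ _) => lt_rq.
    have k0 : (0 < (scaled_pos q t1 - scaled_pos pr t1) / 2)%R by lra.
    have [r r0 hr] := close forward pr _ rt1 k0.
    have [|y [s [taus _ _ + []]]] := near_t1 (Num.min r ((scaled_pos q t1 - scaled_pos pr t1) / 2))%R.
      by rewrite lt_min r0.
    rewrite -(scaled_lt _ _ s) -/(scaled_pos _ _) !lt_min => ly /andP[/hr + _] /andP[_].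
    rewrite /= (le_trans rtau) ?(ltW taus)// => /(_ erefl).
    rewrite !ltr_norml => /andP[? ?] /andP[? ?].
    by have : (0 < 0 :> R)%R by [lra]; rewrite ltxx.
  + have [r r0 hr] := @tanh_nbhs _ t1 (t1 - s) ltac:(lra).
    have [y [s' [_ s'T _ _ [/hr + _]]]] := near_t1 r r0.
    have : coalescing_time pl pr <= s%:E.
      by apply: ereal_inf_lbound; exists s => //; split=> //; rewrite etau lte_fin.
    move=> /(lt_le_trans s'T); rewrite lte_fin ltr_norml => ? /andP[? ?].
    by have : (0 < 0 :> R)%R by [lra]; rewrite ltxx.
- exists (pos q (tau + e / 2)), (tau + e / 2)%R.
  have [|h1 h2] := inw (tau + e / 2)%R; first by apply/andP; lra.
  split=> //; first by rewrite etau lte_fin; lra.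
  (* The sides cannot meet before [tau + e], as [q] separates them strictly until then. *)
  apply: (@lt_le_trans _ _ (tau + e)%:E); first by rewrite lte_fin; lra.
  apply: le_ereal_inf_tmp => _ [s [+ ss] <-]; rewrite etau !lee_fin lte_fin => taus.
  rewrite leNgt; apply/negP => se.
  have [|h3 h4] := inw s; first by rewrite taus.
  by move: (lt_trans h3 h4); rewrite ss ltxx.
Qed.

(* A crossing is a wedge entered from outside: its second side is a path that
   starts on the other side of q, just after the point where q leaves p; by the
   intermediate value theorem this point may be chosen so that q is finite. *)
Lemma avoid_no_cross p q : avoids_wedges K q -> K p -> from_rat p -> no_cross p q.
Proof.
move=> aq Kp rp; apply: no_cross_open => t1 t2 t12 pt1 qt2.
have dom (t : R) : (t1 <= t <= t2)%R -> start p <= t%:E /\ t%:E <= start q.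
  move=> /andP[? ?]; split; first by rewrite (le_trans (ltW pt1)).
  by rewrite (le_trans _ (ltW qt2)).
have pfin (t : R) : (t1 <= t <= t2)%R -> -oo < pos p t < +oo.
  by move=> /dom[/(web_fin gK Kp rp)]; rewrite fin_numElt.
(* For [z] infinite, a zero of [m] is a time at which [q] is halfway, in the scaled coordinate,
   between [p] and [z]: strictly on that side of [p], and not yet at [z]. *)
have mid (z : \bar R) (m := (fun t => scaled_pos q t - (scaled_pos p t + scaled z t) / 2)%R) :
    {within `[t1, t2], continuous m}.
  move=> t; apply: cvgB.
    by apply: scaled_pos_continuousW => {}t /=; rewrite in_itv/= => /dom[].
  apply: cvgM; last exact: cvg_cst.
  apply: cvgD.
    by apply: scaled_pos_continuousW => {}t /=; rewrite in_itv/= => /dom[].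
  by apply: continuous_subspaceT; exact: scaled_continuous.
have sub (c : R) (e : R) : (t1 <= c < t2)%R -> (0 < e)%R ->
    exists r : rat, [/\ (c < ratr r)%R, (ratr r < t2)%R & (`|ratr r - c| < e)%R].
  move=> /andP[t1c ct2] e0.
  have /rat_in_itvoo[r /itvP hr] : (c < Num.min t2 (c + e))%R by rewrite lt_min ct2 ltrDl.
  have : (ratr r < Num.min t2 (c + e))%R by rewrite hr.
  have cr : (c < ratr r)%R by rewrite hr.
  by rewrite lt_min => /andP[? ?]; exists r; split; rewrite ?gtr0_norm ?subr_gt0//; lra.
split=> -[h1 h2].
- have [c ctt [pc cq]] : exists2 c : R, (t1 <= c < t2)%R &
      pos p c < pos q c /\ pos q c < +oo.
    have [qy|] := ltP (pos q t1) +oo; first by exists t1; rewrite ?lexx.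
    rewrite leye_eq => /eqP qy.
    have [|c /[!in_itv]/= ctt mc] := IVT (v := 0%R) (ltW t12) (mid +oo).
      have := pfin t1; rewrite lexx (ltW t12) => /(_ erefl)/andP[_].
      rewrite -(scaled_lt _ _ t1) => p1.
      have := pfin t2; rewrite lexx (ltW t12) => /(_ erefl)/andP[_].
      move: (h2); rewrite -!(scaled_lt _ _ t2) => h3 p2.
      rewrite ge_min le_max; apply/andP; split; apply/orP; [right|left];
        rewrite /scaled_pos ?qy; lra.
    have pc := pfin _ ctt; move/andP: pc => [_]; rewrite -(scaled_lt _ _ c) => pc.
    have lt_pq : pos p c < pos q c.
      by rewrite -(scaled_lt _ _ c); move: mc; rewrite /scaled_pos; lra.
    exists c; last first.
      by split => //; rewrite -(scaled_lt _ _ c); move: mc; rewrite /scaled_pos; lra.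
    move: ctt => /andP[-> ct2]; rewrite lt_neqAle ct2 andbT.
    by apply/eqP => ec; move: lt_pq; rewrite ec ltNge ltW.
  have ctt' : (t1 <= c <= t2)%R by lra.
  have [dp dq] := dom c ctt'.
  have [//|//|e e0 he] := pos_lt_nbhs _ _ pc.
  have qc := cq; rewrite -(scaled_lt _ _ c) in qc.
  have [|||e' e'0 he'] := @within_lt_nbhs _ `[t1, t2] (scaled_pos q) (scaled +oo) c _ _ _ qc.
  + by apply: scaled_pos_continuousW => {}t /=; rewrite in_itv/= => /dom[].
  + by apply: continuous_subspaceT; exact: scaled_continuous.
  + by rewrite /= in_itv.
  have ee0 : (0 < Num.min e e')%R by rewrite lt_min e0.
  have [r [cr rt2]] := sub c _ ctt ee0; rewrite lt_min => /andP[re re'].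
  have [dpr dqr] : start p <= (ratr r)%:E /\ (ratr r)%:E <= start q by apply: dom; lra.
  have [b hb] : exists b : rat, pos q (ratr r) < (ratr b)%:E < (+oo : \bar R).
    apply: rat_between; have := he' (ratr r); rewrite scaled_lt; apply => //=.
    by rewrite in_itv/=; lra.
  have [p' [Kp' rp' sp' pp']] := skeleton_path b r.
  apply: (@wedge_entered q p p' (ratr r) t2) => //.
  + by rewrite /last_start sp'; apply/max_idPr.
  + exact: he.
  + by rewrite pp'; case/andP: hb.
  + by apply: Or31.
- have [c ctt [pc cq]] : exists2 c : R, (t1 <= c < t2)%R &
      pos q c < pos p c /\ -oo < pos q c.
    have [qy|] := ltP -oo (pos q t1); first by exists t1; rewrite ?lexx.
    rewrite leeNy_eq => /eqP qy.
    have [|c /[!in_itv]/= ctt mc] := IVT (v := 0%R) (ltW t12) (mid -oo).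
      have := pfin t1; rewrite lexx (ltW t12) => /(_ erefl)/andP[+ _].
      rewrite -(scaled_lt _ _ t1) => p1.
      have := pfin t2; rewrite lexx (ltW t12) => /(_ erefl)/andP[+ _].
      move: (h2); rewrite -!(scaled_lt _ _ t2) => h3 p2.
      rewrite ge_min le_max; apply/andP; split; apply/orP; [left|right];
        rewrite /scaled_pos ?qy; lra.
    have pc := pfin _ ctt; move/andP: pc => [+ _]; rewrite -(scaled_lt _ _ c) => pc.
    have lt_pq : pos q c < pos p c.
      by rewrite -(scaled_lt _ _ c); move: mc; rewrite /scaled_pos; lra.
    exists c; last first.
      by split => //; rewrite -(scaled_lt _ _ c); move: mc; rewrite /scaled_pos; lra.
    move: ctt => /andP[-> ct2]; rewrite lt_neqAle ct2 andbT.
    by apply/eqP => ec; move: lt_pq; rewrite ec ltNge ltW.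
  have ctt' : (t1 <= c <= t2)%R by lra.
  have [dp dq] := dom c ctt'.
  have [//|//|e e0 he] := pos_lt_nbhs _ _ pc.
  have qc := cq; rewrite -(scaled_lt _ _ c) in qc.
  have [|||e' e'0 he'] := @within_lt_nbhs _ `[t1, t2] (scaled -oo) (scaled_pos q) c _ _ _ qc.
  + by apply: continuous_subspaceT; exact: scaled_continuous.
  + by apply: scaled_pos_continuousW => {}t /=; rewrite in_itv/= => /dom[].
  + by rewrite /= in_itv.
  have ee0 : (0 < Num.min e e')%R by rewrite lt_min e0.
  have [r [cr rt2]] := sub c _ ctt ee0; rewrite lt_min => /andP[re re'].
  have [dpr dqr] : start p <= (ratr r)%:E /\ (ratr r)%:E <= start q by apply: dom; lra.
  have [b hb] : exists b : rat, (-oo : \bar R) < (ratr b)%:E < pos q (ratr r).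
    apply: rat_between; have := he' (ratr r); rewrite scaled_lt; apply => //=.
    by rewrite in_itv/=; lra.
  have [p' [Kp' rp' sp' pp']] := skeleton_path b r.
  apply: (@wedge_entered q p' p (ratr r) t2) => //.
  + by rewrite /last_start sp'; apply/max_idPl.
  + by rewrite pp'; case/andP: hb.
  + exact: he.
  + by apply: Or32.
Qed.

(** If the order were reversed at [s], a path of [K] started between the two just after [s] could
    cross neither, and would separate them in the reversed order at [u]. *)
Lemma dual_order q q' (s u : R) :
  (forall p, K p -> from_rat p -> no_cross p q) ->
  (forall p, K p -> from_rat p -> no_cross p q') ->
  (s < u)%R -> u%:E <= start q -> u%:E <= start q' ->
  pos q' u < pos q u -> pos q' s <= pos q s.
Proof.
move=> nq nq' su qu q'u hu; rewrite leNgt; apply/negP => hs.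
have sq : s%:E <= start q by rewrite (le_trans _ qu)// lee_fin ltW.
have sq' : s%:E <= start q' by rewrite (le_trans _ q'u)// lee_fin ltW.
have [//|//|e e0 he] := pos_lt_nbhs _ _ hs.
have /rat_in_itvoo[r /itvP hr] : (s < Num.min u (s + e))%R by rewrite lt_min su ltrDl.
have : (ratr r < Num.min u (s + e))%R by rewrite hr.
have sr : (s < ratr r)%R by rewrite hr.
rewrite lt_min => /andP[ru re].
have [b /andP[b1 b2]] : exists b : rat, pos q (ratr r) < (ratr b)%:E < pos q' (ratr r).
  apply: rat_between; apply: he => /=.
  - by rewrite (le_trans _ qu)// lee_fin ltW.
  - by rewrite (le_trans _ q'u)// lee_fin ltW.
  - by rewrite gtr0_norm ?subr_gt0//; lra.
have [p [Kp rp sp pp]] := skeleton_path b r.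
have pr : start p <= (ratr r)%:E by rewrite sp.
have [_ h1] := nq _ Kp rp _ _ ru pr qu; have [h2 _] := nq' _ Kp rp _ _ ru pr q'u.
rewrite pp in h1 h2.
by move: hu; rewrite ltNge (le_trans (h1 b1) (h2 b2)).
Qed.

(** The starting time depends continuously on the path, so a cluster point starts exactly at the
    limit of the starts. *)
Lemma compact_start_limit (u : nat -> bwd_path R) (x : \bar R) :
  (forall n, Zs (u n)) ->
  (forall n, start (u n) <= x) ->
  (forall z, z < x -> exists N, forall n, (N <= n)%N -> z < start (u n)) ->
  exists2 q, Zs q & start q = x /\ forall U : set (bwd_path R), open U -> U q ->
    forall N : nat, exists2 n, (N <= n)%N & U (u n).
Proof.
move=> Zu ux xu; have [q Zq hq] := compact_limit_point (dual_compact gZ) Zu.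
exists q => //; split=> //; apply/eqP; rewrite eq_le; apply/andP; split.
  rewrite leNgt; apply/negP => xq.
  have [n _] := hq _ (@open_start_gt _ backward x) xq 0%N.
  by rewrite /= ltNge ux.
rewrite leNgt; apply/negP => qx.
have [r /andP[qr rx]] := rat_between qx.
have [N hN] := xu _ rx.
have [n Nn /=] := hq _ (@open_start_lt _ backward (ratr r)%:E) qr N.
by rewrite ltNge ltW// hN.
Qed.

(** * Paths that avoid the wedges belong to the given set *)

Section Avoiding.
Variable q : bwd_path R.
Hypothesis aq : avoids_wedges K q.

Let ncq p : K p -> from_rat p -> no_cross p q.
Proof. exact: avoid_no_cross. Qed.

Let ncZ q' : Zs q' -> forall p, K p -> from_rat p -> no_cross p q'.
Proof. by move=> Zq' p Kp _; exact: (dual_no_cross gZ). Qed.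

(** [q1] is a limit of paths of [Zs] started at time [u] from rational points increasing to the
    position of [q]; by [dual_order] these stay left of [q]. A path of [K] right of [q1] at [s] is
    right of infinitely many of them, hence not left of their starting points at [u], which gives
    the last clause. *)
Lemma left_limit (u : rat) : (ratr u)%:E <= start q -> -oo < pos q (ratr u) ->
  exists q1, [/\ Zs q1, start q1 = (ratr u)%:E,
    forall s : R, (s < ratr u)%R -> pos q1 s <= pos q s &
    forall p (s : R), K p -> start p <= s%:E -> (s < ratr u)%R ->
      pos q1 s < pos p s -> pos q (ratr u) <= pos p (ratr u)].
Proof.
move=> uq /ereal_approx_left[y yq hy].
have [v hv] := choice (fun n => dual_skeleton_path (y n) u).
have [|||q1 Zq1 [sq1 lq1]] := @compact_start_limit v (ratr u)%:E.
- by move=> n; have [] := hv n.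
- by move=> n; have [_ _ ->] := hv n.
- by move=> z zu; exists 0%N => n _; have [_ _ ->] := hv n.
exists q1; split=> //.
  move=> s su; rewrite leNgt; apply/negP => qs.
  have [|n _ [/= _]] := lq1 _ (@open_pos_gt _ backward (pos q s) s) _ 0%N.
    by rewrite /= sq1 lte_fin.
  have [Zv _ sv pv] := hv n.
  by rewrite ltNge (dual_order ncq (ncZ Zv) su)//= ?sv// pv.
move=> p s Kp ps su q1s; rewrite leNgt; apply/negP => /hy[N hN].
have [|n Nn [/= _]] := lq1 _ (@open_pos_lt _ backward (pos p s) s) _ N.
  by rewrite /= sq1 lte_fin.
have [Zv _ sv pv] := hv n.
have [_ h] := dual_no_cross gZ Kp Zv su ps (eq_ind_r (fun x => _ <= x) (lexx _) sv).
by move=> /h; rewrite pv leNgt hN.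
Qed.

Lemma right_limit (u : rat) : (ratr u)%:E <= start q -> pos q (ratr u) < +oo ->
  exists q2, [/\ Zs q2, start q2 = (ratr u)%:E,
    forall s : R, (s < ratr u)%R -> pos q s <= pos q2 s &
    forall p (s : R), K p -> start p <= s%:E -> (s < ratr u)%R ->
      pos p s < pos q2 s -> pos p (ratr u) <= pos q (ratr u)].
Proof.
move=> uq /ereal_approx_right[y yq hy].
have [v hv] := choice (fun n => dual_skeleton_path (y n) u).
have [|||q2 Zq2 [sq2 lq2]] := @compact_start_limit v (ratr u)%:E.
- by move=> n; have [] := hv n.
- by move=> n; have [_ _ ->] := hv n.
- by move=> z zu; exists 0%N => n _; have [_ _ ->] := hv n.
exists q2; split=> //.
  move=> s su; rewrite leNgt; apply/negP => qs.
  have [|n _ [/= _]] := lq2 _ (@open_pos_lt _ backward (pos q s) s) _ 0%N.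
    by rewrite /= sq2 lte_fin.
  have [Zv _ sv pv] := hv n.
  by rewrite ltNge (dual_order (ncZ Zv) ncq su)//= ?sv// pv.
move=> p s Kp ps su q2s; rewrite leNgt; apply/negP => /hy[N hN].
have [|n Nn [/= _]] := lq2 _ (@open_pos_gt _ backward (pos p s) s) _ N.
  by rewrite /= sq2 lte_fin.
have [Zv _ sv pv] := hv n.
have [h _] := dual_no_cross gZ Kp Zv su ps (eq_ind_r (fun x => _ <= x) (lexx _) sv).
by move=> /h; rewrite pv leNgt hN.
Qed.

(* Otherwise a path of Zs started between p and q, at a rational time at which
   they differ, would be squeezed onto p at time u. *)
Lemma touch_coincide p (a s u : rat) : K p -> starts_at p (ratr a, ratr s) ->
  (s < u)%R -> pos p (ratr u) = pos q (ratr u) ->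
  forall v : R, (ratr u <= v)%R -> v%:E < start q -> pos p v = pos q v.
Proof.
move=> Kp spa su epq v uv vq; have rp : from_rat p by exists a, s.
have [sp _] := spa; rewrite /= in sp.
have pu : start p <= (ratr u)%:E by rewrite sp lee_fin ler_rat ltW.
have pv : start p <= v%:E by rewrite (le_trans pu).
have rat_near (e : R) : (0 < e)%R -> exists w : rat,
    [/\ (v < ratr w)%R, (ratr w)%:E < start q & (`|ratr w - v| < e)%R].
  move=> e0; have [w /andP[vw]] : exists w : rat, v%:E < (ratr w)%:E < mine (start q) (v + e)%:E.
    by apply: rat_between; rewrite lt_min vq lte_fin ltrDl.
  rewrite lt_min !lte_fin in vw * => /andP[wq we].
  by exists w; split=> //; rewrite gtr0_norm ?subr_gt0//; lra.
have pw (w : R) : (v < w)%R -> start p <= w%:E by move=> vw; rewrite (le_trans pv)// lee_fin ltW.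
have uw (w : rat) : (v < ratr w)%R -> (u < w)%R.
  by move=> vw; rewrite -(ltr_rat R) (le_lt_trans uv).
have uwR (w : rat) : (v < ratr w)%R -> (ratr u < ratr w :> R)%R by move=> /uw; rewrite ltr_rat.
have uq (w : rat) : (v < ratr w)%R -> (ratr w)%:E < start q -> (ratr u)%:E <= start q.
  by move=> vw wq; rewrite (le_trans _ (ltW wq))// lee_fin ltW// uwR.
apply/eqP; rewrite eq_le; apply/andP; split; rewrite leNgt; apply/negP => h.
- have [/=||e e0 he] := pos_lt_nbhs _ _ h; [exact: ltW|by []|].
  have [w [vw wq we]] := rat_near e e0.
  have [y /andP[y1 y2]] := rat_between (he (ratr w) (ltW wq) (pw _ vw) we).
  have [q' [Zq' sq'y sq' pq']] := dual_skeleton_path y w.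
  have q'w : (ratr w)%:E <= start q' by rewrite sq'.
  have h1 := @dual_order q' q (ratr u) (ratr w) (ncZ Zq') ncq (uwR _ vw) q'w (ltW wq).
  rewrite pq' in h1.
  have [h2 _] := dual_no_cross gZ Kp Zq' (uwR _ vw) pu q'w.
  have [|lt_pq'|e'] := ltgtP (pos q' (ratr u)) (pos p (ratr u)).
  + by rewrite epq ltNge h1.
  + by move: (h2 lt_pq'); rewrite pq' leNgt y2.
  + by apply: (dual_no_touch gZ Kp Zq' spa sq'y _ e'); rewrite su uw.
- have [/=||e e0 he] := pos_lt_nbhs _ _ h; [by []|exact: ltW|].
  have [w [vw wq we]] := rat_near e e0.
  have [y /andP[y1 y2]] := rat_between (he (ratr w) (pw _ vw) (ltW wq) we).
  have [q' [Zq' sq'y sq' pq']] := dual_skeleton_path y w.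
  have q'w : (ratr w)%:E <= start q' by rewrite sq'.
  have h1 := @dual_order q q' (ratr u) (ratr w) ncq (ncZ Zq') (uwR _ vw) (ltW wq) q'w.
  rewrite pq' in h1.
  have [_ h2] := dual_no_cross gZ Kp Zq' (uwR _ vw) pu q'w.
  have [lt_pq'||e'] := ltgtP (pos q' (ratr u)) (pos p (ratr u)).
  + by move: (h2 lt_pq'); rewrite pq' leNgt y1.
  + by rewrite epq ltNge h1.
  + by apply: (dual_no_touch gZ Kp Zq' spa sq'y _ e'); rewrite su uw.
Qed.

(* The paths of Zs that bound q from both sides do not follow p, so that on both
   sides of q there are paths of K that meet q where p does: together they
   form a wedge that q enters through its tip. *)
Lemma avoid_no_touch p (u : rat) : K p -> from_rat p ->
  start p < (ratr u)%:E -> (ratr u)%:E < start q -> pos p (ratr u) <> pos q (ratr u).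
Proof.
move=> Kp rp pu uq epq.
have [a [s spa]] := rp; have [sp _] := spa; rewrite /= in sp.
have su : (s < u)%R by rewrite sp lte_fin ltr_rat in pu.
have pqE := touch_coincide Kp spa su epq.
have [v /andP[]] := rat_between uq; rewrite lte_fin => uv vq.
have : pos p (ratr v) \is a fin_num.
  by apply: (web_fin gK Kp rp); rewrite (le_trans (ltW pu))// lee_fin ltW.
rewrite (pqE _ (ltW uv) vq) fin_numElt => /andP[nv pv].
have [q1 [Zq1 sq1 q1q hq1]] := left_limit (ltW vq) nv.
have [q2 [Zq2 sq2 q2q hq2]] := right_limit (ltW vq) pv.
pose d : R := ((ratr u + ratr v) / 2)%R.
have ud : (ratr u < d)%R by rewrite /d; lra.
have dv : (d < ratr v)%R by rewrite /d; lra.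
have pt (t : R) : (ratr u <= t)%R -> start p <= t%:E.
  by move=> ut; rewrite (le_trans (ltW pu)).
have pqt (t : R) : (ratr u <= t <= d)%R -> pos p t = pos q t.
  move=> /andP[ut td]; apply: pqE => //; rewrite (lt_trans _ vq)// lte_fin; lra.
(* Neither [q1] nor [q2] can follow [p], which equals [q] up to [d]; so [q] is strictly between them
   at some rational [r]. *)
have [||||c e uc ce ed|c e uc ce ed|r [/andP[ur rd]]] :=
    @dense_lt_pair _ (scaled_pos q1) (scaled_pos p) (scaled_pos p) (scaled_pos q2) _ _ ud.
- by apply: scaled_pos_continuousW => t /andP[_ td]; rewrite /= sq1 lee_fin; lra.
- by apply: scaled_pos_continuousW => t /andP[ut _]; exact: pt.
- by apply: scaled_pos_continuousW => t /andP[ut _]; exact: pt.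
- by apply: scaled_pos_continuousW => t /andP[_ td]; rewrite /= sq2 lee_fin; lra.
- have [||t tce h] := no_coincide_gt Kp Zq1 rp (pt _ uc) ce.
  + by rewrite sq1 lee_fin; lra.
  + by move=> t tce; rewrite pqt; [apply: q1q; lra|lra].
  + by exists t => //; rewrite scaled_lt.
- have [||t tce h] := no_coincide_lt Kp Zq2 rp (pt _ uc) ce.
  + by rewrite sq2 lee_fin; lra.
  + by move=> t tce; rewrite pqt; [apply: q2q; lra|lra].
  + by exists t => //; rewrite scaled_lt.
have rv : (ratr r < ratr v :> R)%R by lra.
rewrite !scaled_lt pqt; last by lra.
move=> /rat_between[b /andP[b1 b2]] /rat_between[b' /andP[b'1 b'2]].
have [p1 [Kp1 rp1 sp1 pp1]] := skeleton_path b r.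
have [p2 [Kp2 rp2 sp2 pp2]] := skeleton_path b' r.
have p1r : start p1 <= (ratr r)%:E by rewrite sp1.
have p2r : start p2 <= (ratr r)%:E by rewrite sp2.
(* [p1] cannot cross to the right of [q]; being right of [q1] at [r], it cannot be left of [q] at
   [v] either. *)
have e1 : pos p1 (ratr v) = pos q (ratr v).
  have [h _] := ncq Kp1 rp1 rv p1r (ltW vq); rewrite pp1 in h.
  apply/eqP; rewrite eq_le h//=; apply: (hq1 _ (ratr r)) => //.
  by rewrite pp1.
have e2 : pos p2 (ratr v) = pos q (ratr v).
  have [_ h] := ncq Kp2 rp2 rv p2r (ltW vq); rewrite pp2 in h.
  apply/eqP; rewrite eq_le h// andbT; apply: (hq2 _ (ratr r)) => //.
  by rewrite pp2.
(* [w] is later than the meeting at [v] and still before the start of [q]. *)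
have [w /andP[]] := rat_between vq; rewrite lte_fin => vw wq.
apply: (@wedge_entered q p1 p2 (ratr r) (ratr w)) => //.
- by rewrite /last_start sp1 sp2 maxxx.
- exact: lt_trans vw.
- by rewrite pp1.
- by rewrite pp2.
- by apply: Or33; exists (ratr v); rewrite ?rv// e1 e2.
Qed.

(** If the left bound [q1] were somewhere strictly left of [q], a path of [K] started between them
    would be at [q] at time [u], against [avoid_no_touch]. *)
Lemma avoid_restriction (u : rat) : (ratr u)%:E < start q ->
  exists q', [/\ Zs q', start q' = (ratr u)%:E &
    forall s : R, (s < ratr u)%R -> pos q' s = pos q s].
Proof.
move=> uq.
have rat_near dir dir' (f : wpath R dir) (g : wpath R dir') (s : R) : (s < ratr u)%R ->
    (forall t : R, (s <= t < ratr u)%R ->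
       time_domain dir (start f) t%:E /\ time_domain dir' (start g) t%:E) ->
    pos f s < pos g s -> exists r b : rat,
    [/\ (ratr r < ratr u :> R)%R, pos f (ratr r) < (ratr b)%:E & (ratr b)%:E < pos g (ratr r)].
  move=> su dom h; have [ds dgs] : time_domain dir (start f) s%:E /\
    time_domain dir' (start g) s%:E by apply: dom; rewrite lexx.
  have [e e0 he] := pos_lt_nbhs ds dgs h.
  have /rat_in_itvoo[r /itvP hr] : (s < Num.min (ratr u) (s + e))%R by rewrite lt_min su ltrDl.
  have : (ratr r < Num.min (ratr u) (s + e))%R by rewrite hr.
  have sr : (s < ratr r)%R by rewrite hr.
  rewrite lt_min => /andP[ru re].
  have [dr dgr] := dom (ratr r) ltac:(lra).
  have [|b /andP[b1 b2]] := rat_between (he _ dr dgr _); last by exists r, b.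
  by rewrite gtr0_norm ?subr_gt0//; lra.
have domq (t : R) : (t < ratr u)%R -> t%:E <= start q.
  by move=> tu; rewrite (le_trans _ (ltW uq))// lee_fin ltW.
have [qu|] := ltP -oo (pos q (ratr u)).
  have [q1 [Zq1 sq1 q1q hq1]] := left_limit (ltW uq) qu.
  exists q1; split=> // s su; apply/eqP; rewrite eq_le q1q//= leNgt; apply/negP.
  move=> /(rat_near _ _ q1 q s su)[|r [b [ru b1 b2]]].
    by move=> t /andP[_ tu]; rewrite /= sq1 domq// lee_fin ltW.
  have [p [Kp rp sp pp]] := skeleton_path b r.
  have pr : start p <= (ratr r)%:E by rewrite sp.
  apply: (@avoid_no_touch p u) => //; first by rewrite sp.
  apply/eqP; rewrite eq_le; apply/andP; split.
    by have [+ _] := ncq Kp rp ru pr (ltW uq); rewrite pp; exact.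
  by apply: (hq1 p (ratr r)) => //; rewrite pp.
(* At [-oo] there is no room on the left. The right bound serves: a path of [K] started between it
   and [q] would reach [-oo], against [web_fin]. *)
rewrite leeNy_eq => /eqP qu.
have [|q2 [Zq2 sq2 q2q hq2]] := right_limit (ltW uq); first by rewrite qu.
exists q2; split=> // s su; apply/eqP; rewrite eq_le q2q// andbT leNgt; apply/negP.
move=> /(rat_near _ _ q q2 s su)[|r [b [ru b1 b2]]].
  by move=> t /andP[_ tu]; rewrite /= sq2 domq// lee_fin ltW.
have [p [Kp rp sp pp]] := skeleton_path b r.
have pr : start p <= (ratr r)%:E by rewrite sp.
have pu : start p <= (ratr u)%:E by rewrite sp lee_fin ltW.
have := hq2 p (ratr r) Kp pr ru; rewrite pp qu leeNy_eq => /(_ b2)/eqP e.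
by have := web_fin gK Kp rp pu; rewrite e.
Qed.

(** Before rational times that increase to its start, [q] agrees with paths of [Zs]; a cluster point
    of these has the start and the positions of [q]. *)
Lemma avoid_dual : Zs q.
Proof.
have [sq|] := ltP -oo (start q).
  have [u uq hu] := ereal_approx_left sq.
  have [v hv] := choice (fun n => avoid_restriction (uq n)).
  have [|||q' Zq' [sq' lq']] := @compact_start_limit v (start q).
  - by move=> n; have [] := hv n.
  - by move=> n; have [_ -> _] := hv n; exact: ltW.
  - by move=> z /hu[N hN]; exists N => n /hN; have [_ -> _] := hv n.
  rewrite -(bwd_path_eq sq' _)// => t; rewrite sq' => tq; have [N hN] := hu _ tq.
  apply/eqP; rewrite eq_le; apply/andP; split; rewrite leNgt; apply/negP => h.
  - have [|n Nn [/= _]] := lq' _ (@open_pos_gt _ backward (pos q t) t) _ N.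
      by rewrite /= sq'.
    by have [_ _ ->] := hv n; rewrite ?ltxx// -lte_fin hN.
  - have [|n Nn [/= _]] := lq' _ (@open_pos_lt _ backward (pos q t) t) _ N.
      by rewrite /= sq'.
    by have [_ _ ->] := hv n; rewrite ?ltxx// -lte_fin hN.
rewrite leeNy_eq => /eqP sq.
(* A backward path that starts at [-oo] has no real times, so there is only one; it is a limit of
   paths started at times [- n]. *)
have [v hv] := choice (fun n : nat => dual_skeleton_path 0 (- n%:R)).
have [q' Zq' hq'] := compact_limit_point (dual_compact gZ) (fun n => let: And4 h _ _ _ := hv n in h).
have sq' : start q' = -oo.
  apply/eqP; rewrite -leeNy_eq leNgt; apply/negP => /rat_between[r /andP[_ rq]].
  have [n Nn /=] := hq' _ (@open_start_gt _ backward (ratr r)%:E) rq (Num.bound `|r|).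
  have [_ _ -> _] := hv n; rewrite lte_fin ltr_rat ltNge lerNl.
  rewrite (le_trans (ler_norm _))// normrN ltW// (lt_le_trans (archi_boundP _))//.
  by rewrite ler_nat.
by rewrite -(bwd_path_eq (etrans sq' (esym sq)) _)// => t; rewrite sq'.
Qed.

End Avoiding.

Lemma good_dual_avoids_wedges : Zs = avoids_wedges K.
Proof.
by apply/seteqP; split; [exact: dual_avoids_wedges|move=> q; exact: avoid_dual].
Qed.

End GoodWebs.

(** * The almost sure properties *)

Lemma measurable_lt_set (R : realType) d (T : measurableType d) (f g : T -> R) :
  measurable_fun setT f -> measurable_fun setT g -> measurable [set w | f w < g w].
Proof.
move=> mf mg; have mlt := measurable_realfun.measurable_fun_ltr mf mg.
have : measurable (setT `&` (fun w => f w < g w) @^-1` [set true]) by exact: mlt.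
by rewrite setTI.
Qed.

(** * Laws of sequences of random variables *)

Section SequenceLaws.
Context {R : realType}.

(** Cylinders over finitely many coordinates: a pi-system that generates the product
    sigma-algebra. *)
Definition rectangles : set (set (nat -> R)) :=
  [set E | exists A : nat -> set R, [/\ forall l, measurable (A l),
     exists m, forall l, (m <= l)%N -> A l = setT & E = [set x | forall l, A l (x l)]]].

Notation seqspace := (g_sigma_algebraType rectangles).

Lemma rectangles_setI : setI_closed rectangles.
Proof.
move=> _ _ [A [mA [m hm] ->]] [B [mB [n hn] ->]].
exists (fun l => A l `&` B l); split.
- by move=> l; exact: measurableI.
- exists (maxn m n) => l; rewrite geq_max => /andP[ml nl].
  by rewrite hm// hn// setIT.
- by apply/seteqP; split=> [x [hA hB] l|x h]; [split; [exact: hA|exact: hB]|split=> l; case: (h l)].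
Qed.

Lemma rectangle_preimage d (T : measurableType d) (f : nat -> T -> R) (A : nat -> set R) m :
  (forall l, (m <= l)%N -> A l = setT) ->
  [set w | forall l, A l (f l w)] = \bigcap_(l in [set: 'I_m]) [set w | A l (f l w)].
Proof.
move=> hm; apply/seteqP; split=> [w h l _|w h l]; first exact: h.
have [lm|ml] := ltnP l m; first exact: (h (Ordinal lm) I).
by rewrite hm.
Qed.

Lemma measurable_seq d (T : measurableType d) (f : nat -> T -> R) :
  (forall l, measurable_fun setT (f l)) ->
  measurable_fun setT (fun w => (fun l => f l w) : seqspace).
Proof.
move=> mf; apply: (@measurability _ _ T seqspace setT _ rectangles) => // _ [_ [A [mA [m hm] ->]] <-].
rewrite setTI /preimage/= (rectangle_preimage _ hm).
apply: fin_bigcap_measurable => [|l _]; first exact: finite_finset.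
by rewrite -[X in measurable X]setTI; exact: mf.
Qed.

Lemma measurable_coordinate l : measurable_fun setT (fun x : seqspace => x l).
Proof.
move=> _ A mA; rewrite setTI; apply: sub_sigma_algebra.
exists (fun k => if k == l then A else setT); split.
- by move=> k; case: ifP.
- by exists l.+1 => k; case: eqP => // ->; rewrite ltnn.
- apply/seteqP; split=> [x Ax k|x /(_ l)]; last by rewrite eqxx.
  by case: eqP => // ->.
Qed.

(** Uniqueness of measures on a pi-system. Two spaces are allowed, to replace the web by its model,
    and finite measures, to derive independence in [independent_pair]. *)
Lemma law_unique d (T : measurableType d) d' (T' : measurableType d')
    (mu : {measure set T -> \bar R}) (nu : {measure set T' -> \bar R})
    (f : nat -> T -> R) (g : nat -> T' -> R) :
  (mu setT < +oo)%E ->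
  (forall l, measurable_fun setT (f l)) -> (forall l, measurable_fun setT (g l)) ->
  (forall m (A : 'I_m -> set R), (forall l, measurable (A l)) ->
    mu (\bigcap_(l in [set: 'I_m]) [set w | A l (f l w)]) =
    nu (\bigcap_(l in [set: 'I_m]) [set w | A l (g l w)])) ->
  forall E : set seqspace, measurable E ->
    mu [set w | E (fun l => f l w)] = nu [set w | E (fun l => g l w)].
Proof.
move=> fin mf mg h E mE.
pose F := fun w => (fun l => f l w) : seqspace.
pose G := fun w => (fun l => g l w) : seqspace.
have mF : measurable_fun setT F by exact: measurable_seq.
have mG : measurable_fun setT G by exact: measurable_seq.
pose muF : {measure set seqspace -> \bar R} :=
  measure_function_pushforward__canonical__measure_function_Measure mu mF.
pose nuG : {measure set seqspace -> \bar R} :=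
  measure_function_pushforward__canonical__measure_function_Measure nu mG.
apply: (@measure_unique _ R seqspace rectangles (fun=> setT) erefl rectangles_setI
  _ _ muF nuG) => //=.
- by move=> _; exists (fun=> setT); split=> //; [exists 0%N|apply/seteqP; split].
- by rewrite bigcup_const.
- move=> _ [A [mA [m hm] ->]]; rewrite /pushforward /preimage/=.
  by rewrite !(rectangle_preimage _ hm); apply: (h _ (fun l => A l)).
Qed.

End SequenceLaws.

Notation seqspace R := (g_sigma_algebraType (@rectangles R)).

(** * Meetings of continuous functions as measurable events *)

Section Meetings.
Context {R : realType}.

(* an enumeration of b and of the rational times in [a, b] *)
Definition rat_time (a b : R) (j : nat) : R :=
  if j is j'.+1 then
    if unpickle j' is Some q then
      if a <= ratr q <= b then ratr (q : rat) else b
    else b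
  else b.

Lemma rat_time_itv a b j : a <= b -> a <= rat_time a b j <= b.
Proof.
move=> ab; case: j => [|j] /=; rewrite ?ab ?lexx//.
by case: unpickle => [q|]; rewrite ?ab ?lexx//; case: ifP => //; rewrite ab lexx.
Qed.

Lemma rat_time_rat a b (q : rat) : a <= ratr q <= b -> exists j, rat_time a b j = ratr q.
Proof. by move=> h; exists (pickle q).+1; rewrite /= pickleK h. Qed.

(** The distance of two continuous functions attains its minimum on a compact interval, so they meet
    once it is arbitrarily small. Rational times suffice to see this, which makes meeting an event
    on countably many coordinates. *)
Lemma near_meetP (f g : R -> R) (a b : R) : a < b ->
  {within `[a, b], continuous f} -> {within `[a, b], continuous g} ->
  (forall n : nat, exists j, `|f (rat_time a b j) - g (rat_time a b j)| < n.+1%:R^-1) <->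
  exists2 s, a <= s <= b & f s = g s.
Proof.
move=> ab cf cg; pose h t := f t - g t.
have ch : {within `[a, b], continuous h} by move=> t; apply: cvgB; [exact: cf|exact: cg].
split=> [near0|[s sab fgs] n].
  have cnh : {within `[a, b], continuous (fun t => `|h t|)}.
    by move=> t; apply: cvg_norm; exact: ch.
  have [c /[!in_itv]/= cab cmin] := EVT_min (ltW ab) cnh.
  exists c => //; apply/eqP; rewrite -subr_eq0 -normr_eq0; apply: contrapT => /negP hc0.
  have {}hc0 : 0 < `|h c| by rewrite lt_neqAle eq_sym hc0 normr_ge0.
  have [j] := near0 (Num.bound `|h c|^-1).
  rewrite ltNge => /negP; apply.
  apply: (@le_trans _ _ `|h c|); last first.
    by apply: cmin; rewrite in_itv/= rat_time_itv// ltW.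
  rewrite -[leRHS]invrK lef_pV2 ?posrE ?invr_gt0//.
  apply: (le_trans (ltW (archi_boundP _))); first by rewrite invr_ge0 ltW.
  by rewrite ler_nat.
have n0 : 0 < n.+1%:R^-1 :> R by rewrite invr_gt0.
have [|e e0 he] := (within_continuousP _ _).1 ch s _ _ n0; first by rewrite /= in_itv.
have /rat_in_itvoo[q /itvP hq] : Num.max a (s - e) < Num.min b (s + e).
  by rewrite lt_min !gt_max ab; lra.
have : Num.max a (s - e) < ratr q by rewrite hq.
have : ratr q < Num.min b (s + e) by rewrite hq.
rewrite lt_min gt_max => /andP[qb qe] /andP[aq eq].
have [|j jq] := @rat_time_rat a b q; first by rewrite !ltW.
exists j; rewrite jq.
have := he (ratr q); rewrite /h /= in_itv/= fgs subrr subr0; apply.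
  by rewrite !ltW.
by rewrite ltr_norml; lra.
Qed.

(** Meeting times form a closed set, so their infimum is one; [coalescing_paths] refers to this
    first time. *)
Lemma first_meet (f g : R -> R) (a b s0 : R) :
  {within `[a, b], continuous f} -> {within `[a, b], continuous g} ->
  a <= s0 <= b -> f s0 = g s0 ->
  exists s, [/\ a <= s <= b, f s = g s & forall s', a <= s' -> s' < s -> f s' <> g s'].
Proof.
move=> cf cg s0ab fgs0.
pose S := [set s | a <= s <= b /\ f s = g s].
have hS : has_inf S by split; [exists s0|exists a => s [/andP[]]].
have aS : a <= inf S by apply: lb_le_inf => [|s [/andP[]]//]; exists s0.
have Ss0 : inf S <= s0 by apply: ge_inf; [exact: hS.2|].
have Sab : a <= inf S <= b by rewrite aS; case/andP: s0ab => _; exact: le_trans.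
exists (inf S); split => //; last first.
  move=> s' as' s'S e; move: (s'S); rewrite ltNge => /negP; apply.
  apply: ge_inf; [exact: hS.2|split=> //].
  by case/andP: Sab => _; rewrite as' /=; exact/le_trans/ltW.
apply: contrapT => /eqP; rewrite -subr_eq0 -normr_gt0 => h0.
have ch : {within `[a, b], continuous (fun t => f t - g t)}.
  by move=> t; apply: cvgB; [exact: cf|exact: cg].
have [|e e0 he] := (within_continuousP _ _).1 ch (inf S) _ _ h0; first by rewrite /= in_itv.
have [s [sab fgs] se] := inf_adherent e0 hS.
have Ss : inf S <= s by apply: ge_inf; [exact: hS.2|].
have := he s; rewrite /= in_itv/= fgs subrr sub0r normrN ltxx sab => /(_ erefl) k.
by suff /k : `|s - inf S| < e by []; rewrite ger0_norm ?subr_ge0//; lra.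
Qed.

(** Even coordinates carry the first function and odd ones the second, as arranged by [pair_seq]. *)
Definition near_meeting : set (seqspace R) :=
  [set x | forall n : nat, exists j : nat, `|x j.*2 - x j.*2.+1| < n.+1%:R^-1].

Lemma measurable_near_meeting : measurable near_meeting.
Proof.
rewrite (_ : near_meeting = \bigcap_(n in [set: nat]) \bigcup_(j in [set: nat])
    [set x : seqspace R | `|x j.*2 - x j.*2.+1| < n.+1%:R^-1]); last first.
  apply/seteqP; split=> [x h n _|x h n]; first by have [j] := h n; exists j.
  by have [j _] := h n I; exists j.
apply: bigcapT_measurable => n; apply: bigcupT_measurable => j.
apply: measurable_lt_set => //.
apply: measurableT_comp => //.
by apply: measurable_realfun.measurable_funB; exact: measurable_coordinate.
Qed.

End Meetings.

(** * The first two of a family of coalescing paths *)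

Section CoalescingPair.
Context {R : realType} (k : nat) (z : 'I_k -> R * R) (b c : 'I_k -> R -> R).
Variables i0 i1 : 'I_k.
Hypotheses (vi0 : i0 = 0%N :> nat) (vi1 : i1 = 1%N :> nat).
Hypothesis bc : coalescing_paths z b c.
Hypothesis cb : forall i, {within [set t | (z i).2 <= t], continuous (b i)}.
Let a := Num.max (z i0).2 (z i1).2.

Let z0a : (z i0).2 <= a. Proof. by rewrite le_max lexx. Qed.
Let z1a : (z i1).2 <= a. Proof. by rewrite le_max lexx orbT. Qed.

Let lt_i1 (j : 'I_k) : (j < i1)%N -> j = i0.
Proof. by rewrite vi1 ltnS leqn0 => /eqP j0; apply: ord_inj; rewrite j0 vi0. Qed.

Lemma coalescing_fst t : (z i0).2 <= t -> c i0 t = b i0 t.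
Proof. by move=> /bc[+ _]; apply => j s _ [+ _ _ _]; rewrite vi0. Qed.

Lemma coalescing_snd_before t : a <= t ->
  (forall s, a <= s <= t -> b i0 s <> b i1 s) -> c i1 t = b i1 t.
Proof.
move=> at_ h; have [+ _] := bc (le_trans z1a at_); apply => j s st [/lt_i1 -> h1 h0].
by rewrite coalescing_fst//; apply: h; rewrite ge_max h0 h1.
Qed.

Lemma coalescing_snd_after t : (exists2 s, a <= s <= t & b i0 s = b i1 s) -> c i1 t = c i0 t.
Proof.
move=> [s0 s0at e0].
have cW i : (z i).2 <= a -> {within `[a, t], continuous (b i)}.
  move=> zia; apply: continuous_subspaceW (@cb i) => s /=.
  by rewrite in_itv/= => /andP[/(le_trans zia)].
have [s [/andP[as_ st] e first]] := first_meet (cW _ z0a) (cW _ z1a) s0at e0.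
have [_] := bc (le_trans z1a (le_trans as_ st)); apply; first exact: st.
  split; [by rewrite vi0 vi1|exact: le_trans as_|exact: le_trans as_|].
  by rewrite coalescing_fst// (le_trans z0a).
move=> j s' s's [/lt_i1 -> h1 h0]; rewrite coalescing_fst//.
by apply: first => //; rewrite ge_max h0 h1.
Qed.

(** An earlier meeting would make the paths agree at [t]. This turns events about coalescing paths
    into events about the underlying motions. *)
Lemma coalescing_distinct t : a <= t -> c i0 t <> c i1 t ->
  (forall s, a <= s <= t -> b i0 s <> b i1 s) /\
  (forall s, a <= s <= t -> c i0 s = b i0 s /\ c i1 s = b i1 s).
Proof.
move=> at_ ne; have h s : a <= s <= t -> b i0 s <> b i1 s.
  by move=> sat e; apply: ne; rewrite coalescing_snd_after//; exists s.
split=> // s /andP[as_ st]; split.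
  by rewrite coalescing_fst// (le_trans z0a).
apply: coalescing_snd_before => // s' /andP[as' s's]; apply: h.
by rewrite as' (le_trans s's).
Qed.

End CoalescingPair.

Section PairSequence.
Context {R : realType} {T : Type}.

Definition pair_seq (a b : R) (U V : R -> T -> R) (l : nat) : T -> R :=
  (if odd l then V else U) (rat_time a b l./2).

Lemma near_meeting_pair a b U V w :
  near_meeting (fun l => pair_seq a b U V l w) <->
  forall n : nat, exists j, `|U (rat_time a b j) w - V (rat_time a b j) w| < n.+1%:R^-1.
Proof.
by split=> h n; have [j hj] := h n; exists j; move: hj;
  rewrite /pair_seq /= odd_double /= doubleK uphalf_double.
Qed.

End PairSequence.

Lemma measurable_ne_set (R : realType) d (T : measurableType d) (f g : T -> R) :
  measurable_fun setT f -> measurable_fun setT g -> measurable [set w | f w <> g w].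
Proof.
move=> mf mg; rewrite (_ : mkset _ = [set w | f w < g w] `|` [set w | g w < f w]).
  by apply: measurableU; exact: measurable_lt_set.
apply/seteqP; split=> w /=; first by move=> /eqP; rewrite neq_lt => /orP.
by move=> [h e|h e]; move: h; rewrite e ltxx.
Qed.

(** * Two paths that have met do not separate *)

Section BrownianWeb.
Context {R : realType} {d : measure_display} {T : measurableType d}.
Variable P : probability T R.

(** The event concerns countably many times, so it has the same probability for the model paths [C].
    There it is empty: paths that differ at [tau] have followed motions that did not meet. *)
Lemma meet_null (z : 'I_2 -> R * R) (X : 'I_2 -> R -> T -> R) (tau : R) :
  let a := Num.max (z ord0).2 (z ord_max).2 in
  coalescing_brownian_motions P z X -> a < tau ->
  P.-negligible [set w | X ord0 tau w <> X ord_max tau w /\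
    near_meeting (fun l => pair_seq a tau (X ord0) (X ord_max) l w)].
Proof.
move=> a [mX [d' [T' [P' [B [C [bmB _ BC mC XC]]]]]]] atau.
pose i (l : nat) : 'I_2 := if odd l then ord_max else ord0.
have pairE (S : Type) (Y : 'I_2 -> R -> S -> R) l :
    pair_seq a tau (Y ord0) (Y ord_max) l = Y (i l) (rat_time a tau l./2).
  by rewrite /pair_seq /i; case: odd.
have ti l : (z (i l)).2 <= rat_time a tau l./2.
  have /andP[+ _] := rat_time_itv l./2 (ltW atau); apply: le_trans.
  by rewrite /i /a; case: odd; rewrite le_max lexx ?orbT.
have mXl l : measurable_fun setT (pair_seq a tau (X ord0) (X ord_max) l).
  by rewrite pairE; exact: mX.
have mCl l : measurable_fun setT (pair_seq a tau (C ord0) (C ord_max) l).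
  by rewrite pairE; exact: mC.
(* [rat_time] starts with the right end [tau], so coordinates 0 and 1 are the two positions at time
   [tau]. *)
pose E : set (seqspace R) := [set x | x 0%N <> x 1%N] `&` near_meeting.
have mE : measurable E.
  apply: measurableI; last exact: measurable_near_meeting.
  by apply: measurable_ne_set; exact: measurable_coordinate.
exists [set w | E (fun l => pair_seq a tau (X ord0) (X ord_max) l w)]; split.
- have := measurable_seq mXl measurableT mE.
  by rewrite setTI.
- rewrite (@law_unique _ _ _ _ _ P P' (pair_seq a tau (X ord0) (X ord_max))
    (pair_seq a tau (C ord0) (C ord_max)))//.
  + rewrite (_ : [set w | _] = set0) ?measure0//; apply/seteqP; split=> w //= [ne].
    have cB j : {within [set t | (z j).2 <= t], continuous (fun t => B j t w)}.
      by case: (bmB j).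
    have [//|//||h1 h2] := coalescing_distinct (i0 := ord0) (i1 := ord_max) _ _ (BC w) cB (ltW atau).
      exact: ne.
    have cW j : (z j).2 <= a -> {within `[a, tau], continuous (fun t => B j t w)}.
      move=> zja; apply: continuous_subspaceW (@cB j) => s /=.
      by rewrite in_itv/= => /andP[/(le_trans zja)].
    have za j : (z j).2 <= a.
      have [->|->] : j = ord0 \/ j = ord_max.
        by case: j => [[|[|//]] hj]; [left|right]; exact: val_inj.
      - by rewrite /a le_max lexx.
      - by rewrite /a le_max lexx orbT.
    move=> /near_meeting_pair near.
    have [|s sa] := (near_meetP atau (cW ord0 (za _)) (cW ord_max (za _))).1; last exact: h1.
    move=> n; have [l hl] := near n; exists l.
    by have [<- <-] := h2 _ (rat_time_itv l (ltW atau)).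
  + by rewrite -ge0_fin_numE// fin_num_measure.
  + move=> m A mA; have := XC m (fun l => i l) (fun l => rat_time a tau l./2) A.
    rewrite (_ : pair_seq _ _ (X _) _ = fun l => X (i l) (rat_time a tau l./2)).
      rewrite (_ : pair_seq _ _ (C _) _ = fun l => C (i l) (rat_time a tau l./2)).
        by apply.
      by apply/funext => l; exact: pairE.
    by apply/funext => l; exact: pairE.
- by move=> w [].
Qed.

Lemma ae_forall_count (I : countType) (Q : I -> T -> Prop) :
  (forall i, {ae P, forall w, Q i w}) -> {ae P, forall w, forall i, Q i w}.
Proof.
move=> h; have : {ae P, forall w, forall n : nat,
    (if unpickle n is Some i then Q i w else True)}.
  apply/ae_foralln => n; case: unpickle => [i|]; first exact: h.
  exact: aeW.
by apply: filterS => w hw i; have := hw (pickle i); rewrite pickleK.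
Qed.

End BrownianWeb.

(** Multiplication by [1 + |t|] turns the scaled position into [tanh (x t)], and [tanh_nbhs] undoes
    [tanh]. *)
Lemma pos_real_continuous (R : realType) dir (p : wpath R dir) (x : R -> R) (D : set R) :
  (forall t, D t -> time_domain dir (start p) t%:E /\ pos p t = (x t)%:E) ->
  {within D, continuous x}.
Proof.
move=> h; apply/within_continuousP => t0 Dt0 e e0.
have [e' e'0 he'] := tanh_nbhs (x t0) e0.
have c1 : {within D, continuous (fun t : R => 1 + `|t|)}.
  apply: continuous_subspaceT => t.
  by apply: cvgD; [exact: cvg_cst|apply: cvg_norm].
have ctanh : {within D, continuous (fun t => scaled_pos p t * (1 + `|t|))}.
  move=> t; apply: cvgM.
    by apply: scaled_pos_continuousW => {}t /h[].
  exact: c1.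
have tanhE t : D t -> scaled_pos p t * (1 + `|t|) = tanh (x t).
  by move=> /h[_ e1]; rewrite /scaled_pos /scaled e1 divfK// gt_eqF// ltr_pwDl.
have [r r0 hr] := (within_continuousP _ _).1 ctanh t0 Dt0 e' e'0.
exists r => // t Dt tt0; apply: he'; rewrite distrC.
by have := hr t Dt tt0; rewrite !tanhE.
Qed.

(** * Bounds from the Gaussian density *)

Section Gaussian.
Context {R : realType}.
Local Open Scope ereal_scope.

Lemma normal_prob_le (m s : R) (A : set R) : s != 0%R -> measurable A ->
  normal_prob m s A <= (normal_peak s)%:E * lebesgue_measure A.
Proof.
move=> s0 mA; rewrite /normal_prob -integral_cst//.
apply: ge0_le_integral => //.
- by move=> x _; rewrite lee_fin normal_pdf_ge0.
- apply/measurable_realfun.measurable_EFinP; apply: measurable_funTS; exact: measurable_normal_pdf.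
- by move=> x _; rewrite lee_fin normal_pdf_ub.
Qed.

Context {d : measure_display} {T : measurableType d}.
Variable P : probability T R.

Lemma brownian_le (z : R * R) (B : R -> T -> R) (t : R) (A : set R) :
  brownian_motion P z B -> (z.2 < t)%R -> measurable A ->
  P [set w | A (B t w - z.1)%R] <=
  (normal_peak (Num.sqrt (t - z.2)))%:E * lebesgue_measure A.
Proof.
move=> [B0 _ _ Bn _] zt mA.
have -> : [set w | A (B t w - z.1)%R] = [set w | A (B t w - B z.2 w)%R].
  by apply/seteqP; split=> w /=; rewrite B0.
rewrite Bn//; apply: normal_prob_le => //.
by rewrite gt_eqF// sqrtr_gt0 subr_gt0.
Qed.

Lemma brownian_itv (z : R * R) (B : R -> T -> R) (t a b : R) :
  brownian_motion P z B -> (z.2 < t)%R -> (a < b)%R ->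
  P [set w | (a < B t w < b)%R] <= (normal_peak (Num.sqrt (t - z.2)) * (b - a))%:E.
Proof.
move=> bmB zt ab; have := brownian_le bmB zt (measurable_itv `](a - z.1)%R, (b - z.1)%R[).
rewrite lebesgue_measure_itv/= lte_fin ltrD2r ab -EFinB -EFinM opprB addrA subrK.
congr (P _ <= _); apply/seteqP; split=> w /=; rewrite in_itv/= ?ltrD2r//.
Qed.

Lemma brownian_noatom (z : R * R) (B : R -> T -> R) (t x : R) :
  brownian_motion P z B -> (z.2 < t)%R -> P [set w | B t w = x] = 0.
Proof.
move=> bmB zt; have := brownian_le bmB zt (measurable_set1 (x - z.1)%R).
rewrite lebesgue_measure_set1 mule0 => h; apply/eqP; rewrite eq_le measure_ge0 andbT.
apply: le_trans h; rewrite le_eqVlt; apply/orP; left; apply/eqP; congr (P _).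
by apply/seteqP; split=> w /=; [move=> ->|move=> /addIr].
Qed.

End Gaussian.

(** * Independence of three motions *)

Section Independence.
Context {R : realType}.
Local Open Scope ereal_scope.

Let i0 : 'I_3 := ord0.
Let i1 : 'I_3 := Ordinal (isT : (1 < 3)%N).
Let i2 : 'I_3 := Ordinal (isT : (2 < 3)%N).

Let I3P (i : 'I_3) : [\/ i = i0, i = i1 | i = i2].
Proof.
by case: i => [[|[|[|//]]] hi]; [constructor 1|constructor 2|constructor 3]; exact: val_inj.
Qed.

Let bigcap_I3 (S : Type) (F : 'I_3 -> set S) :
  \bigcap_(i in [set: 'I_3]) F i = F i0 `&` F i1 `&` F i2.
Proof.
apply/seteqP; split=> [w h|w [[h0 h1] h2] i _]; first by split; [split|]; exact: h.
by case: (I3P i) => ->.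
Qed.

(** For fixed [D] both sides are finite measures in [E]: [P] restricted to the event for [B i2], and
    [P] scaled by its probability. By [law_unique] it suffices to compare them on cylinders, where
    independence applies. *)
Lemma independent_pair d (T : measurableType d) (P : probability T R) (z : 'I_3 -> R * R) (B : 'I_3 -> R -> T -> R) (a b s : R)
    (D : set R) (E : set (seqspace R)) :
  (forall i t, ((z i).2 <= t)%R -> measurable_fun setT (B i t)) ->
  independent_processes P z B ->
  ((z i0).2 <= a)%R -> ((z i1).2 <= a)%R -> ((z i2).2 <= s)%R -> (a <= b)%R ->
  measurable D -> measurable E ->
  P ([set w | E (fun l => pair_seq a b (B i0) (B i1) l w)] `&` [set w | D (B i2 s w)]) =
  P [set w | D (B i2 s w)] * P [set w | E (fun l => pair_seq a b (B i0) (B i1) l w)].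
Proof.
move=> mB iB z0a z1a z2s ab mD mE.
have pairE : pair_seq a b (B i0) (B i1) =
    fun l => B (if odd l then i1 else i0) (rat_time a b l./2).
  by apply/funext => l; rewrite /pair_seq; case: odd.
have zt (i : 'I_3) l : i <> i2 -> ((z i).2 <= rat_time a b l)%R.
  have /andP[+ _] := rat_time_itv l ab.
  by case: (I3P i) => -> // at_ _; apply: le_trans at_.
have mp l : measurable_fun setT (pair_seq a b (B i0) (B i1) l).
  by rewrite pairE; apply: mB; case: odd; exact: zt.
have mD2 : measurable [set w | D (B i2 s w)].
  by rewrite -[X in measurable X]setTI; exact: mB.
have c0 : (0 <= fine (P [set w | D (B i2 s w)]))%R by exact: fine_ge0.
have cE : (NngNum c0)%:num%:E = P [set w | D (B i2 s w)] :> \bar R.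
  by rewrite /= fineK// fin_num_measure.
rewrite -cE.
apply: (@law_unique _ _ _ _ _ (mrestr P mD2) (mscale (NngNum c0) P)
  (pair_seq a b (B i0) (B i1)) (pair_seq a b (B i0) (B i1))) => //.
  rewrite /= /mrestr setTI -ge0_fin_numE ?measure_ge0//.
  exact: fin_num_measure.
move=> m A mA; rewrite /= /mrestr /mscale cE.
pose A' (l : nat) := if insub l is Some l' then A (l' : 'I_m) else setT.
have mA' l : measurable (A' l) by rewrite /A'; case: insub.
have A'E (l : 'I_m) : A' l = A l by rewrite /A' insubT// => ?; congr A; exact: val_inj.
have {}A'T l : (m <= l)%N -> A' l = setT.
  by move=> ml; rewrite /A' insubF// ltnNge ml.
(* The third motion is observed at [s] for every index, and [m.+1] indices guarantee at least one.
   Even indices constrain [B i0], odd ones [B i1]. *)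
pose t (i : 'I_3) (l : 'I_m.+1) : R := if i == i2 then s else rat_time a b l./2.
pose Q (D' : set R) (i : 'I_3) (l : 'I_m.+1) : set R :=
  if i == i2 then D' else if (i == i1) == odd l then A' l else setT.
have tz i j : ((z i).2 <= t i j)%R.
  by rewrite /t; case: eqP => [->//|]; exact: zt.
have mQ D' i j : measurable D' -> measurable (Q D' i j).
  by move=> mD'; rewrite /Q; case: ifP => // _; case: ifP.
pose F D' i := \bigcap_(j in [set: 'I_m.+1]) [set w | Q D' i j (B i (t i j) w)].
have F01 D' : F D' i0 `&` F D' i1 =
    \bigcap_(l in [set: 'I_m]) [set w | A l (pair_seq a b (B i0) (B i1) l w)].
  have QE (i : 'I_3) (j : 'I_m.+1) (w : T) : i <> i2 -> Q D' i j (B i (t i j) w) <->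
      ((i == i1) = odd j -> A' j (B i (rat_time a b j./2) w)).
    move=> /eqP/negbTE ii2; rewrite /Q /t ii2; case: eqP => [e|ne]; first by split=> // h; exact: h.
    by split=> // _ e; case: ne.
  apply/seteqP; split=> [w [h0 h1] l _ /=|w h].
    rewrite pairE -A'E; pose j := widen_ord (leqnSn m) l.
    case ol : (odd l).
      by have /QE := h1 j I; apply; rewrite ?eqxx ?ol.
    by have /QE := h0 j I; apply; rewrite ?ol.
  have hA' (j : nat) : A' j (pair_seq a b (B i0) (B i1) j w).
    have [jm|mj] := ltnP j m; last by rewrite A'T.
    by have := h (Ordinal jm) I; rewrite /= -A'E.
  by split=> j _ /=; apply/QE => // e; have := hA' j; rewrite pairE -e.
have F2 D' : F D' i2 = [set w | D' (B i2 s w)].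
  by apply/seteqP; split=> [w /(_ ord0 I)//|w h j _].
have prodF D' : measurable D' -> P (F D' i0 `&` F D' i1 `&` F D' i2) =
    P (F D' i0) * P (F D' i1) * P (F D' i2).
  move=> mD'; have := iB _ t (Q D') tz (fun i j => mQ D' i j mD').
  have mF i : measurable (F D' i).
    apply: fin_bigcap_measurable => [|j _]; first exact: finite_finset.
    rewrite -[X in measurable X]setTI; apply: mB => //.
    exact: mQ.
  rewrite bigcap_I3 => ->.
  rewrite !big_ord_recl big_ord0 mulr1 mulrA !EFinM !fineK; try by apply: fin_num_measure; exact: mF.
  by congr (_ * P (F D' _) * P (F D' _)); exact: val_inj.
have FE i : i <> i2 -> F D i = F setT i.
  by move=> /eqP/negbTE ii2; rewrite /F /Q ii2.
have := prodF _ mD; rewrite F01 F2 => ->.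
rewrite muleC; congr (_ * _).
(* With [setT] for [D] the same factorisation recombines the first two motions. *)
rewrite !FE//; have := prodF _ measurableT; rewrite F01 F2.
rewrite setIT probability_setT mule1 => h; exact: esym h.
Qed.

(* The path listed last can only meet the other two from time u on, so that its
   position at time u is that of a Brownian motion independent of them. *)
Lemma triple_bound d (T : measurableType d) (P : probability T R)
    (z : 'I_3 -> R * R) (X : 'I_3 -> R -> T -> R) (y u v a b : R) :
  coalescing_brownian_motions P z X ->
  (z i0).2 = u -> (z i1).2 = u -> ((z i2).2 < u)%R -> (u < v)%R -> (a < b)%R ->
  P [set w | X i0 v w < y < X i1 v w /\ a < X i2 u w < b]%R <=
  (normal_peak (Num.sqrt (u - (z i2).2)) * (b - a))%:E *
    P [set w | X i0 v w < y < X i1 v w]%R.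
Proof.
move=> [mX [d' [T' [P' [B [C [bmB iB BC mC XC]]]]]]] z0u z1u z2u uv ab.
have uuv : (u <= u <= v)%R by rewrite lexx ltW.
pose S (T0 : Type) (Y : 'I_3 -> R -> T0 -> R) (D : set R) : set T0 :=
  [set w | (Y i0 v w < y < Y i1 v w)%R /\ D (Y i2 u w)].
have SE D : measurable D -> P (S T X D) = P' (S T' C D).
  move=> mD; pose A (l : 'I_3) : set R :=
    if l == i0 then `]-oo, y[%classic else if l == i1 then `]y, +oo[%classic else D.
  pose t (l : 'I_3) := if l == i2 then u else v.
  have SA (T0 : Type) (Y : 'I_3 -> R -> T0 -> R) :
      S T0 Y D = \bigcap_(l in [set: 'I_3]) [set w | A l (Y l (t l) w)].
    rewrite bigcap_I3 /S /A /t /=; apply/seteqP; split=> w /=; rewrite !in_itv/= ?andbT.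
      by move=> [/andP[]].
    by move=> [[-> ->]].
  rewrite !SA; apply: (XC _ id t A) => l.
  - by rewrite /t; case: (I3P l) => ->; rewrite ?z0u ?z1u ltW.
  - by rewrite /A; case: ifP => // _; case: ifP.
(* [y] is between the motions at [v] and they have not met; this is the event for the coalescing
   paths, which would agree at [v] after a meeting. *)
pose E : set (seqspace R) :=
  [set x | (x 0%N < y)%R] `&` [set x | (y < x 1%N)%R] `&` ~` near_meeting.
have mE : measurable E.
  apply: measurableI; last by apply: measurableC; exact: measurable_near_meeting.
  by apply: measurableI; apply: measurable_lt_set => //; exact: measurable_coordinate.
have mB i t : ((z i).2 <= t)%R -> measurable_fun setT (B i t) by case: (bmB i) => ? ? + _ _; apply.
pose U w := E (fun l => pair_seq u v (B i0) (B i1) l w).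
have CB w : (C i0 v w < y < C i1 v w)%R <-> U w.
  have cB j : {within [set t | ((z j).2 <= t)%R], continuous (fun t => B j t w)}.
    by case: (bmB j).
  have zu j : j <> i2 -> (z j).2 = u by case: (I3P j) => ->.
  have cW j : j <> i2 -> {within `[u, v], continuous (fun t => B j t w)}.
    move=> /zu zj; apply: continuous_subspaceW (@cB j) => s /=.
    by rewrite in_itv/= zj => /andP[].
  have m0 : Num.max (z i0).2 (z i1).2 = u by rewrite z0u z1u maxxx.
  have C0 : C i0 v w = B i0 v w.
    by apply: (coalescing_fst (i0 := i0) erefl (BC w)); rewrite z0u ltW.
  have vv : (u <= v <= v)%R by rewrite lexx ltW.
  split=> [/andP[c0 c1]|[[/= b0 b1] nm]].
    have ne : C i0 v w <> C i1 v w by move=> e; move: (lt_trans c0 c1); rewrite e ltxx.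
    have [|h1 h2] := coalescing_distinct (i0 := i0) (i1 := i1) erefl erefl (BC w) cB _ ne.
      by rewrite m0 ltW.
    rewrite m0 in h1 h2; have [e0 e1] := h2 v vv.
    split; first by rewrite /= -[X in (X < y)%R]e0 -[X in (y < X)%R]e1.
    move=> /near_meeting_pair/(near_meetP uv (cW i0 _) (cW i1 _))[//|//|s su].
    exact: h1.
  rewrite C0 (coalescing_snd_before (i0 := i0) (i1 := i1) erefl erefl (BC w)).
  - by rewrite b0 b1.
  - by rewrite m0 ltW.
  - rewrite m0 => s su e; apply: nm; apply/near_meeting_pair.
    by apply/(near_meetP uv (cW i0 _) (cW i1 _)) => //; exists s.
(* A meeting by time [u] takes place at [u] itself, where the path switched to has the same
   position. *)
have C2 w : C i2 u w = B i2 u w.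
  have [h1 h2] := BC w i2 u (ltW z2u).
  have [[j [s [su m]]]|no] := pselect (exists j s, (s <= u)%R /\
      Defs.meets z (fun i t => B i t w) (fun i t => C i t w) i2 j s); last first.
    by apply: h1 => j s su m; apply: no; exists j, s.
  have zu (k : 'I_3) : (k < i2)%N -> (z k).2 = u by case: (I3P k) => ->.
  have [ji _ zs e] := m.
  have es : s = u by apply/eqP; rewrite eq_le su -(zu _ ji).
  subst s; rewrite (h2 j u (lexx _) m)// => j' s' s'u [/zu z'u _ +].
  by rewrite z'u leNgt s'u.
have mD : measurable `]a, b[%classic by exact: measurable_itv.
have -> : [set w | X i0 v w < y < X i1 v w /\ a < X i2 u w < b]%R = S T X `]a, b[%classic.
  by rewrite /S; apply/seteqP; split=> w /=; rewrite in_itv.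
have -> : [set w | X i0 v w < y < X i1 v w]%R = S T X setT.
  by rewrite /S; apply/seteqP; split=> w /=; [|case].
rewrite !SE//.
have -> : S T' C `]a, b[%classic = [set w | U w] `&` [set w | `]a, b[%classic (B i2 u w)].
  by rewrite /S; apply/seteqP; split=> w /= [/CB h]; rewrite C2.
have -> : S T' C setT = [set w | U w].
  by rewrite /S; apply/seteqP; split=> w /=; [case=> /CB|move=> /CB].
rewrite (independent_pair mB iB) ?z0u ?z1u ?(ltW z2u) ?(ltW uv)//.
apply: lee_pmul => //.
exact: (brownian_itv (bmB i2) z2u ab).
Qed.

End Independence.

(** * Almost sure properties of the web *)

Section Webs.
Context {R : realType} {d : measure_display} {T : measurableType d}.
Variables (P : probability T R) (W : T -> Hspace R).
Hypothesis web_W : brownian_web P W.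

Lemma measure_ae_le (A B : set T) : measurable A -> measurable B ->
  {ae P, forall w, A w -> B w} -> (P A <= P B)%E.
Proof.
move=> mA mB [N [mN N0 hN]].
have AB : A `<=` B `|` N.
  by move=> w Aw; have [Bw|nB] := pselect (B w); [left|right; apply: hN => /(_ Aw)].
have mBN : measurable (B `|` N) by exact: measurableU.
apply: (le_trans (le_measure P _ _ AB)); rewrite ?inE//.
by have := measureU2 P mB mN; rewrite [X in (_ + X)%E]N0 adde0.
Qed.

(** One measurable version per starting point, fixed by choice. With a single path the coalescing
    model is a Brownian motion, whence the absence of atoms. *)
Lemma web_values : exists Y : R * R -> R -> T -> R, forall z,
  [/\ forall t, z.2 <= t -> measurable_fun setT (Y z t),
      {ae P, forall w, forall p, compact_set (W w) p -> starts_at p z ->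
         forall t, z.2 <= t -> pos p t = (Y z t w)%:E} &
      forall t x, z.2 < t -> {ae P, forall w, Y z t w <> x}].
Proof.
suff h (z : R * R) : exists Yz : R -> T -> R,
    [/\ forall t, z.2 <= t -> measurable_fun setT (Yz t),
      {ae P, forall w, forall p, compact_set (W w) p -> starts_at p z ->
         forall t, z.2 <= t -> pos p t = (Yz t w)%:E} &
      forall t x, z.2 < t -> {ae P, forall w, Yz t w <> x}].
  by have [Y hY] := choice h; exists Y.
have [_ _ web3 _] := web_W; have [X [cbX valX]] := web3 1%N (fun=> z).
exists (X ord0); have [mX [d' [T' [P' [B [C [bmB _ BC _ XC]]]]]]] := cbX.
split=> [t|//|t x zt]; first exact: mX.
  by move: valX; apply: filterS => w h p; exact: (h ord0).
apply: (negligibleS (A := [set w | X ord0 t w = x])) => [w /= /contrapT//|].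
have mXt := mX ord0 t (ltW zt).
apply/negligibleP; first by have := mXt measurableT _ (measurable_set1 x); rewrite setTI.
have := XC 1%N (fun=> ord0) (fun=> t) (fun=> [set x]) (fun=> ltW zt) (fun=> measurable_set1 x).
have I1 (S : Type) (F : set S) : \bigcap_(l in [set: 'I_1]) F = F.
  by rewrite bigcap_const//; exists ord0.
rewrite !I1 => e; rewrite -(brownian_noatom x (bmB ord0) zt).
transitivity (P' [set w | C ord0 t w = x]); first exact: e.
congr (P' _).
have CB w : C ord0 t w = B ord0 t w.
  by apply: (coalescing_fst (i0 := ord0) erefl (BC w)); rewrite ltW.
by apply/seteqP; split=> w /=; rewrite CB.
Qed.

(** Paths that meet at [t1] and differ at [t2] still differ at a rational time after [t2], so
    countably many null sets from [meet_null] suffice. *)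
Lemma coalesce_ae (z0 z1 : R * R) : {ae P, forall w, forall p p',
  compact_set (W w) p -> compact_set (W w) p' -> starts_at p z0 -> starts_at p' z1 ->
  forall t1 t2, t1 <= t2 -> (start p <= t1%:E)%E -> (start p' <= t1%:E)%E ->
  pos p t1 = pos p' t1 -> pos p t2 = pos p' t2}.
Proof.
pose z (i : 'I_2) := if i == ord0 then z0 else z1.
have [_ _ web3 _] := web_W; have [X [cbX valX]] := web3 2%N z.
pose a := Num.max (z ord0).2 (z ord_max).2.
have null : {ae P, forall w, forall q : rat, a < ratr q ->
    ~ (X ord0 (ratr q) w <> X ord_max (ratr q) w /\
       near_meeting (fun l => pair_seq a (ratr q) (X ord0) (X ord_max) l w))}.
  apply: ae_forall_count => q; have [aq|qa] := ltP a (ratr q); last exact: aeW.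
  by apply: negligibleS (meet_null cbX aq) => w /= h; apply: contrapT => nh; apply: h.
move: null valX; apply: filterS2 => w null val p p' Wp Wp' [/= sp pp] [/= sp' pp'].
move=> t1 t2 t12 pt1 p't1 e1; apply: contrapT => ne2.
have at1 : a <= t1 by rewrite ge_max -!lee_fin -[z _]/z0 -[z ord_max]/z1 -sp -sp' pt1.
have at2 : a <= t2 by exact: le_trans t12.
have pX t : a <= t -> (start p <= t%:E)%E /\ pos p t = (X ord0 t w)%:E.
  rewrite ge_max => /andP[+ _]; rewrite -[z _]/z0 => zt; split; first by rewrite sp lee_fin.
  exact: (val ord0 p).
have p'X t : a <= t -> (start p' <= t%:E)%E /\ pos p' t = (X ord_max t w)%:E.
  rewrite ge_max => /andP[_ +]; rewrite -[z _]/z1 => zt; split; first by rewrite sp' lee_fin.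
  exact: (val ord_max p').
have cX b : {within `[a, b], continuous (fun t => X ord0 t w)}.
  by apply: (@pos_real_continuous _ forward p) => t; rewrite /= in_itv/= => /andP[/pX].
have cX' b : {within `[a, b], continuous (fun t => X ord_max t w)}.
  by apply: (@pos_real_continuous _ forward p') => t; rewrite /= in_itv/= => /andP[/p'X].
have lt12 : t1 < t2.
  by rewrite lt_neqAle t12 andbT; apply/eqP => e; apply: ne2; rewrite -e.
have [e e0 he] : exists2 e : R, 0 < e & forall t, t2 <= t -> `|t - t2| < e -> pos p t <> pos p' t.
  have dom t : t2 <= t -> (start p <= t%:E)%E /\ (start p' <= t%:E)%E.
    by move=> /(le_trans at2) at_; rewrite (pX _ at_).1 (p'X _ at_).1.
  have [d1 d2] := dom t2 (lexx _).
  move: ne2 => /eqP; rewrite neq_lt => /orP[] /pos_lt_nbhs [//|//|e e0 he]; exists e => // t t2t tt.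
    by have [h1 h2] := dom t t2t; move: (he t h1 h2 tt) => /[swap] ->; rewrite ltxx.
  by have [h1 h2] := dom t t2t; move: (he t h2 h1 tt) => /[swap] ->; rewrite ltxx.
have /rat_in_itvoo[q /itvP hq] : t2 < t2 + e by rewrite ltrDl.
have t2q : t2 < ratr q by rewrite hq.
have qe : ratr q < t2 + e by rewrite hq.
have aq : a < ratr q by apply: le_lt_trans t2q.
apply: (null q aq); split.
  move=> eX; apply: (he (ratr q) (ltW t2q)); first by rewrite gtr0_norm ?subr_gt0//; lra.
  by rewrite (pX _ (ltW aq)).2 (p'X _ (ltW aq)).2 eX.
apply/near_meeting_pair; apply/(near_meetP aq (cX _) (cX' _)); exists t1.
  by rewrite at1 (le_trans t12)// ltW.
by move: e1; rewrite (pX _ at1).2 (p'X _ at1).2 => -[].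
Qed.

Lemma measure_ae_eq (A B : set T) : measurable A -> measurable B ->
  {ae P, forall w, A w <-> B w} -> P A = P B.
Proof.
move=> mA mB AB; apply/eqP; rewrite eq_le; apply/andP; split.
  by apply: measure_ae_le => //; move: AB; apply: filterS => w [].
by apply: measure_ae_le => //; move: AB; apply: filterS => w [].
Qed.

(** Removing the earlier sets changes each set by a null set only and makes the sequence
    disjoint. *)
Lemma sum_ae_disjoint (G : nat -> set T) : (forall k, measurable (G k)) ->
  (forall j k, (j < k)%N -> {ae P, forall w, ~ (G j w /\ G k w)}) ->
  (\sum_(0 <= k <oo) P (G k) <= 1)%E.
Proof.
move=> mG dG; have mD := seqDU_measurable mG.
have GD k : P (G k) = P (seqDU G k).
  apply: measure_ae_eq => //.
  have : {ae P, forall w, forall j, (j < k)%N -> ~ (G j w /\ G k w)}.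
    apply/ae_foralln => j; have [jk|kj] := ltnP j k; last exact: aeW.
    by move: (dG j k jk); apply: filterS.
  apply: filterS => w h; split=> [Gk|[]//]; split=> //.
  by rewrite -bigcup_mkord => -[j jk Gj]; apply: (h j).
under eq_eseriesr do rewrite GD.
have mU : measurable (\bigcup_k seqDU G k) by exact: bigcupT_measurable.
rewrite -(measure_semi_bigcup P mD (trivIset_seqDU G) mU).
exact: probability_le1.
Qed.

Variable Y : R * R -> R -> T -> R.
Hypothesis measurable_Y : forall z t, z.2 <= t -> measurable_fun setT (Y z t).
Hypothesis value_Y : forall z, {ae P, forall w, forall p, compact_set (W w) p ->
  starts_at p z -> forall t, z.2 <= t -> pos p t = (Y z t w)%:E}.
Hypothesis noatom_Y : forall z t x, z.2 < t -> {ae P, forall w, Y z t w <> x}.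

Lemma exists_path z : {ae P, forall w, exists p, compact_set (W w) p /\ starts_at p z}.
Proof.
by have [_ web2 _ _] := web_W; move: (web2 z); apply: filterS => w [p [h _]]; exists p.
Qed.

Lemma version_Y k (z : 'I_k -> R * R) (X : 'I_k -> R -> T -> R) i t :
  {ae P, forall w, forall i p, compact_set (W w) p -> starts_at p (z i) ->
     forall t, (z i).2 <= t -> pos p t = (X i t w)%:E} ->
  (z i).2 <= t -> {ae P, forall w, X i t w = Y (z i) t w}.
Proof.
move=> valX zt; move: (exists_path (z i)) valX (value_Y (z i)); apply: filterS3.
by move=> w [p [Wp sp]] h1 h2; move: (h1 i p Wp sp t zt); rewrite (h2 p Wp sp t zt) => -[].
Qed.

(** The family given by [brownian_web] depends on the three starting points; summing over cells
    requires a common version. *)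
Lemma triple_bound_Y (y a b a' b' s u v c : R) : s < u -> u < v -> a' < b' ->
  (P [set w | (Y (a, u) v w < y < Y (b, u) v w) /\ a' < Y (c, s) u w < b']%R <=
  (normal_peak (Num.sqrt (u - s)) * (b' - a'))%:E *
    P [set w | Y (a, u) v w < y < Y (b, u) v w]%R)%E.
Proof.
move=> su uv ab'.
pose z (i : 'I_3) := if val i == 0%N then (a, u) else if val i == 1%N then (b, u) else (c, s).
have [_ _ web3 _] := web_W; have [X [cbX valX]] := web3 3%N z.
have := triple_bound y cbX erefl erefl su uv ab'.
set A := (X in (P X <= _)%E); set B := (X in (_ <= _ * P X)%E).
have mX := cbX.1.
have e0 : {ae P, forall w, X ord0 v w = Y (a, u) v w}.
  exact: (version_Y (z := z) (i := ord0) valX (ltW uv)).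
have e1 : {ae P, forall w, X (Ordinal (isT : (1 < 3)%N)) v w = Y (b, u) v w}.
  exact: (version_Y (z := z) (i := Ordinal (isT : (1 < 3)%N)) valX (ltW uv)).
have e2 : {ae P, forall w, X (Ordinal (isT : (2 < 3)%N)) u w = Y (c, s) u w}.
  exact: (version_Y (z := z) (i := Ordinal (isT : (2 < 3)%N)) valX (ltW su)).
have mset (f g : T -> R) (y1 y2 : R) : measurable_fun setT f -> measurable_fun setT g ->
    measurable [set w | f w < y1 /\ y2 < g w].
  move=> mf mg; rewrite (_ : mkset _ = [set w | f w < y1] `&` [set w | y2 < g w])//.
  by apply: measurableI; exact: measurable_lt_set.
have mB (f g : T -> R) : measurable_fun setT f -> measurable_fun setT g ->
    measurable [set w | f w < y < g w].
  move=> mf mg; rewrite (_ : mkset _ = [set w | f w < y /\ y < g w]); first exact: mset.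
  by apply/seteqP; split=> w /=; [move/andP|move=> /andP].
have mA (f g h : T -> R) : measurable_fun setT f -> measurable_fun setT g ->
    measurable_fun setT h -> measurable [set w | f w < y < g w /\ a' < h w < b'].
  move=> mf mg mh; rewrite (_ : mkset _ =
    [set w | f w < y < g w] `&` [set w | h w < b' /\ a' < h w]).
    by apply: measurableI; [exact: mB|exact: mset].
  apply/seteqP; split=> w /=; first by move=> [? /andP[? ?]].
  by move=> [? [? ?]]; split=> //; apply/andP.
have mY0 : measurable_fun setT (Y (a, u) v) by apply: measurable_Y; exact: ltW.
have mY1 : measurable_fun setT (Y (b, u) v) by apply: measurable_Y; exact: ltW.
have mY2 : measurable_fun setT (Y (c, s) u) by apply: measurable_Y; exact: ltW.
have mX0 : measurable_fun setT (X ord0 v) by apply: mX; exact: ltW.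
have mX1 : measurable_fun setT (X (Ordinal (isT : (1 < 3)%N)) v) by apply: mX; exact: ltW.
have mX2 : measurable_fun setT (X (Ordinal (isT : (2 < 3)%N)) u) by apply: mX; exact: ltW.
have -> : P A = P [set w | (Y (a, u) v w < y < Y (b, u) v w) /\ a' < Y (c, s) u w < b'].
  apply: measure_ae_eq; [exact: mA|exact: mA|].
  by move: e0 e1 e2; apply: filterS3 => w; rewrite /A /= => -> -> ->.
have -> : P B = P [set w | Y (a, u) v w < y < Y (b, u) v w].
  apply: measure_ae_eq; [exact: mB|exact: mB|].
  by move: e0 e1; apply: filterS2 => w; rewrite /B /= => -> ->.
by [].
Qed.

Lemma ae_and (A B : T -> Prop) : {ae P, forall w, A w} -> {ae P, forall w, B w} ->
  {ae P, forall w, A w /\ B w}.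
Proof. by apply: filterS2. Qed.

(** Reversing the initial order requires a meeting, after which the paths agree. *)
Lemma order_Y (a b u v : R) : a <= b -> u < v ->
  {ae P, forall w, Y (a, u) v w <= Y (b, u) v w}.
Proof.
move=> ab uv; have := coalesce_ae (a, u) (b, u).
have := ae_and (exists_path (a, u)) (exists_path (b, u)).
have := ae_and (value_Y (a, u)) (value_Y (b, u)).
apply: filterS3 => w [val1 val2] [[p [Wp sp]] [p' [Wp' sp']]] coal.
have uv' := ltW uv; rewrite -lee_fin -(val1 p Wp sp v)// -(val2 p' Wp' sp' v)//.
rewrite leNgt; apply/negP => h.
have dom (t : R) : u <= t <= v -> (start p <= t%:E)%E /\ (start p' <= t%:E)%E.
  by rewrite sp.1 sp'.1 !lee_fin => /andP[].
have [|t tuv e] := @pos_meet _ forward forward p p' u v uv' dom _ (ltW h).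
  by rewrite -[u]/((a, u).2) sp.2 /= -[u]/((b, u).2) sp'.2.
have [d1 d2] := dom t tuv; case/andP: tuv => ut tv.
by move: h; rewrite (coal p p' Wp Wp' sp sp' t v tv d1 d2 e) ltxx.
Qed.

(** A grid of mesh [1 / (n + 1)] that begins at [- M], so that for large [M] natural indices reach
    any given real number. *)
Let cell (M n k : nat) : R := k%:R / n.+1%:R - M%:R.

(* For given n, the conditions on the first two processes exclude one another for
   distinct k, and by [triple_bound] the third condition costs a factor O(1/n). *)
Lemma touch_negligible (c s u v y : R) (M : nat) : s < u -> u < v ->
  P.-negligible [set w | forall n, exists k,
    (Y (cell M n k, u) v w < y < Y (cell M n k.+1, u) v w) /\
    cell M n k < Y (c, s) u w < cell M n k.+1].
Proof.
move=> su uv; pose K := normal_peak (Num.sqrt (u - s)).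
have K0 : 0 <= K by exact: normal_peak_ge0.
pose G n k := [set w | Y (cell M n k, u) v w < y < Y (cell M n k.+1, u) v w].
pose H n k := [set w | cell M n k < Y (c, s) u w < cell M n k.+1].
have cellS n k : cell M n k.+1 - cell M n k = n.+1%:R^-1.
  by rewrite /cell -natr1; ring.
have cell_lt n k : cell M n k < cell M n k.+1 by rewrite -subr_gt0 cellS invr_gt0.
have mset (f g : T -> R) (y1 y2 : R) : measurable_fun setT f -> measurable_fun setT g ->
    measurable [set w | f w < y1 /\ y2 < g w].
  move=> mf mg; rewrite (_ : mkset _ = [set w | f w < y1] `&` [set w | y2 < g w])//.
  by apply: measurableI; exact: measurable_lt_set.
have mG n k : measurable (G n k).
  rewrite (_ : G n k = [set w | Y (cell M n k, u) v w < y /\ y < Y (cell M n k.+1, u) v w]).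
    by apply: mset; apply: measurable_Y; exact: ltW.
  by apply/seteqP; split=> w /=; [move/andP|move=> /andP].
have mH n k : measurable (H n k).
  rewrite (_ : H n k = [set w | Y (c, s) u w < cell M n k.+1 /\ cell M n k < Y (c, s) u w]).
    by apply: mset; apply: measurable_Y; exact: ltW.
  by apply/seteqP; split=> w /=; [move=> /andP[]|move=> [? ?]; apply/andP].
pose N := \bigcap_(n in [set: nat]) \bigcup_(k in [set: nat]) (G n k `&` H n k).
have mGH n : measurable (\bigcup_(k in [set: nat]) (G n k `&` H n k)).
  by apply: bigcupT_measurable => k; exact: measurableI.
have mN : measurable N by exact: bigcapT_measurable.
have PN n : (P N <= (K / n.+1%:R)%:E)%E.
  apply: (@le_trans _ _ (\sum_(0 <= k <oo) P (G n k `&` H n k))%E).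
    apply: measure_sigma_subadditive => //; first by move=> k; exact: measurableI.
    by move=> w; apply.
  apply: (@le_trans _ _ (\sum_(0 <= k <oo) ((K / n.+1%:R)%:E * P (G n k))))%E.
    apply: lee_nneseries => // k _.
    have := triple_bound_Y y (cell M n k) (cell M n k.+1) c su uv (cell_lt n k).
    by rewrite cellS.
  have KN : 0 <= K / n.+1%:R by rewrite divr_ge0.
  rewrite nneseriesZl// -[leRHS]mule1; apply: lee_wpmul2l; first by rewrite lee_fin.
  apply: sum_ae_disjoint => // j k jk.
  have cjk : cell M n j.+1 <= cell M n k.
    by rewrite /cell lerD2r ler_pM2r ?invr_gt0// ler_nat.
  move: (order_Y cjk uv); apply: filterS => w le_jk [/andP[_ h1] /andP[h2 _]].
  by move: (lt_trans h1 (le_lt_trans le_jk h2)); rewrite ltxx.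
exists N; split => //; last first.
  by move=> w h n _; have [k [? ?]] := h n; exists k.
have finN : P N \is a fin_num by exact: fin_num_measure.
apply/eqP; rewrite eq_le measure_ge0 andbT -(fineK finN) lee_fin leNgt; apply/negP => x0.
(* For this [n] the bound [K / (n + 1)] is below [P N]. *)
have := PN (Num.bound (K / fine (P N))); rewrite -(fineK finN) lee_fin leNgt => /negP; apply.
rewrite ltr_pdivrMr// -ltr_pdivrMl// mulrC.
apply: lt_le_trans (archi_boundP _) _; first by rewrite divr_ge0// ltW.
by rewrite ler_nat.
Qed.

(** If both paths were at [x] at time [u], then for each [n] the paths of the web from the ends of
    the cell around [x], not crossing [q], would enclose [y] at time [v]: the event of
    [touch_negligible]. *)
Lemma no_touch_ae (Z : T -> set (bwd_path R)) (c s u v y : R) : s < u -> u < v ->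
  {ae P, forall w, forall p q, compact_set (W w) p -> Z w q -> no_cross p q} ->
  {ae P, forall w, forall p q, compact_set (W w) p -> Z w q ->
    starts_at p (c, s) -> starts_at q (y, v) -> pos q u <> pos p u}.
Proof.
move=> su uv ncr.
(* The absence of atoms makes the inequalities strict: no path from a cell end is at [y] at time
   [v], and [Y (c, s) u] is not a cell end. *)
have cells : {ae P, forall w, forall i : nat * nat * nat,
    let z := (cell i.1.1 i.1.2 i.2, u) in
    [/\ exists p, compact_set (W w) p /\ starts_at p z,
        forall p, compact_set (W w) p -> starts_at p z ->
          forall t, z.2 <= t -> pos p t = (Y z t w)%:E,
        Y z v w <> y & Y (c, s) u w <> z.1]}.
  apply: ae_forall_count => i /=; set z := (_, u).
  have := ae_and (noatom_Y y (z := z) uv) (noatom_Y z.1 (z := (c, s)) su).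
  by move: (exists_path z) (value_Y z); apply: filterS3 => w ? ? [].
have off : {ae P, forall w, forall M, ~ forall n, exists k,
    (Y (cell M n k, u) v w < y < Y (cell M n k.+1, u) v w) /\
    cell M n k < Y (c, s) u w < cell M n k.+1}.
  apply/ae_foralln => M; apply: negligibleS (touch_negligible c y M su uv) => w /=.
  by move=> /contrapT.
have := ae_and ncr (value_Y (c, s)); move: cells off; apply: filterS3.
move=> w cells off [nc val] p q Wp Zq sp sq e.
set x := Y (c, s) u w in cells off; have px : pos p u = x%:E by exact/(val p Wp sp)/ltW.
(* [M] exceeds the absolute value of [x], so [x + M] is nonnegative and its truncation in units of
   the mesh gives [k]. *)
apply: (off (Num.bound `|x|)) => n; set M := Num.bound `|x|.
have x0 : 0 <= (x + M%:R) * n.+1%:R.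
  rewrite mulr_ge0//; have := archi_boundP (normr_ge0 x); rewrite -/M => xM.
  by have := ler_norm (- x); rewrite normrN; lra.
have /andP[k1 k2] := truncn_itv x0.
set k := Num.trunc _ in k1 k2; exists k.
have [[p1 [Wp1 sp1]] val1 y1 x1] := cells (M, n, k).
have [[p2 [Wp2 sp2]] val2 y2 x2] := cells (M, n, k.+1).
rewrite /= in sp1 val1 y1 x1 sp2 val2 y2 x2.
have c1 : cell M n k < x.
  by rewrite lt_neqAle; apply/andP; split; [apply/eqP => /esym|rewrite lerBlDr ler_pdivrMr].
have c2 : x < cell M n k.+1.
  by rewrite ltrBrDr ltr_pdivlMr.
have uv' := ltW uv.
have [s1 s1u] := sp1; have [s2 s2u] := sp2; have [sq1 sq2] := sq; rewrite /= in s1 s1u s2 s2u sq1 sq2.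
have h1 : (pos p1 v <= pos q v)%E.
  have [||+ _] := nc p1 q Wp1 Zq u v uv; rewrite ?s1 ?sq1//; apply.
  by rewrite s1u e px lte_fin.
have h2 : (pos q v <= pos p2 v)%E.
  have [||_ +] := nc p2 q Wp2 Zq u v uv; rewrite ?s2 ?sq1//; apply.
  by rewrite s2u e px lte_fin.
rewrite sq2 (val1 p1 Wp1 sp1 v uv') lee_fin in h1.
rewrite sq2 (val2 p2 Wp2 sp2 v uv') lee_fin in h2.
split; last by rewrite c1 c2.
rewrite !lt_neqAle h1 h2 !andbT; apply/andP; split; apply/eqP; first exact: y1.
by move=> /esym.
Qed.

Lemma rat_points_dense : dense [set z : R * R | exists a s : rat, z = (ratr a, ratr s)].
Proof.
move=> O [z Oz] oO; have /nbhs_ballP[e /= e0 he] := open_nbhs_nbhs (conj oO Oz).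
have /rat_in_itvoo[a /itvP ha] : z.1 - e < z.1 + e by lra.
have /rat_in_itvoo[s /itvP hs] : z.2 - e < z.2 + e by lra.
have [a1 a2] : z.1 - e < ratr a /\ ratr a < z.1 + e by rewrite !ha.
have [s1 s2] : z.2 - e < ratr s /\ ratr s < z.2 + e by rewrite !hs.
exists (ratr a, ratr s); split; last by exists a, s.
by apply: he; split => /=; rewrite /ball/= ltr_norml; lra.
Qed.

Lemma rat_points_countable :
  countable [set z : R * R | exists a s : rat, z = (ratr a, ratr s)].
Proof.
apply: (@sub_countable _ _ _ ((fun i : rat * rat => (ratr i.1, ratr i.2)) @` setT)).
  by apply: subset_card_le => _ [a [s ->]]; exists (a, s).
by apply: (sub_countable (card_image_le _ _)); exact: countableP.
Qed.

(** Rational starting points leave countably many almost sure statements to combine, and serve as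
    the dense set in the closure property. *)
Lemma good_web_ae : {ae P, forall w, good_web (compact_set (W w))}.
Proof.
have [_ _ _ web4] := web_W.
have paths : {ae P, forall w, forall i : rat * rat,
    (exists p, compact_set (W w) p /\ starts_at p (ratr i.1, ratr i.2)) /\
    (forall p, compact_set (W w) p -> starts_at p (ratr i.1, ratr i.2) ->
      forall t, (ratr i.2 : R) <= t -> pos p t = (Y (ratr i.1, ratr i.2) t w)%:E)}.
  by apply: ae_forall_count => i; exact: ae_and (exists_path _) (value_Y _).
have coal : {ae P, forall w, forall i : (rat * rat) * (rat * rat), forall p p',
    compact_set (W w) p -> compact_set (W w) p' ->
    starts_at p (ratr i.1.1, ratr i.1.2) -> starts_at p' (ratr i.2.1, ratr i.2.2) ->
    forall t1 t2, t1 <= t2 -> (start p <= t1%:E)%E -> (start p' <= t1%:E)%E ->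
    pos p t1 = pos p' t1 -> pos p t2 = pos p' t2}.
  by apply: ae_forall_count => i; exact: coalesce_ae.
move: paths coal (web4 _ rat_points_countable rat_points_dense); apply: filterS3.
move=> w paths coal clo; split.
- by move=> a s; have [[p [Wp sp]] _] := paths (a, s); exists p.
- move=> p Wp [a [s sp]] t pt; have [_ /(_ p Wp sp t)] := paths (a, s).
  by move: pt; rewrite sp.1 lee_fin => pt /(_ pt) ->.
- move=> p; rewrite {1}clo; apply: closure_subset => p' [Wp' [z [a [s ->]] sp']].
  by split=> //; exists a, s.
- move=> p p' Wp Wp' [a [s sp]] [a' [s' sp']].
  exact: (coal ((a, s), (a', s')) p p' Wp Wp' sp sp').
Qed.

Lemma good_dual_ae (Z : T -> Hhat R) :
  (forall z : R * R, {ae P, forall w, exists2 q, compact_set (Z w) q & starts_at q z}) ->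
  {ae P, forall w,
     ~ exists p q, [/\ compact_set (W w) p, compact_set (Z w) q & crosses p q]} ->
  {ae P, forall w, forall p q, compact_set (W w) p -> compact_set (Z w) q ->
     ~ coincide_on_interval p q} ->
  {ae P, forall w, good_dual (compact_set (W w)) (compact_set (Z w))}.
Proof.
move=> Zst Zcr Zco.
have nc : {ae P, forall w, forall p q, compact_set (W w) p -> compact_set (Z w) q -> no_cross p q}.
  by move: Zcr; apply: filterS => w h p q Wp Zq; apply: no_crossP => c; apply: h; exists p, q.
have paths : {ae P, forall w, forall i : rat * rat,
    exists2 q, compact_set (Z w) q & starts_at q (ratr i.1, ratr i.2)}.
  by apply: ae_forall_count => i; exact: Zst.
have touch : {ae P, forall w, forall i : (rat * rat) * (rat * rat) * rat,
    (i.1.1.2 < i.2)%R -> (i.2 < i.1.2.2)%R -> forall p q,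
    compact_set (W w) p -> compact_set (Z w) q ->
    starts_at p (ratr i.1.1.1, ratr i.1.1.2) -> starts_at q (ratr i.1.2.1, ratr i.1.2.2) ->
    pos q (ratr i.2) <> pos p (ratr i.2)}.
  apply: ae_forall_count => i; have [h1|h1] := ltP i.1.1.2 i.2; last exact: aeW.
  have [h2|h2] := ltP i.2 i.1.2.2; last by apply: aeW => w _.
  have := @no_touch_ae (fun w => compact_set (Z w)) (ratr i.1.1.1) (ratr i.1.1.2) (ratr i.2)
    (ratr i.1.2.2) (ratr i.1.2.1) _ _ nc.
  by rewrite !ltr_rat => /(_ h1 h2); apply: filterS => w h _ _; exact: h.
have := ae_and paths touch; move: nc Zco; apply: filterS3 => w nc co [pa to]; split.
- exact: compact_setP.
- by move=> y u; exact: (pa (y, u)).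
- exact: nc.
- exact: co.
- move=> p q a s y v u Wp Zq sp sq /andP[su uv].
  exact: (to ((a, s), (y, v), u) su uv p q Wp Zq sp sq).
Qed.

End Webs.

Lemma compacts_eq (R : realType) dir (K L : compacts R dir) :
  compact_set K = compact_set L -> K = L.
Proof.
case: K L => [K cK] [L cL] /= e; subst L; congr Compacts; exact: Prop_irrelevance.
Qed.

Theorem proposition2p7 (R : realType) (d : measure_display)
  (T : measurableType d) (P : probability T R)
  (W : T -> Hspace R) (Z What : T -> Hhat R)
  (measurable_WZ : measurable_fun setT (fun w => (W w, Z w)))
  (web_W : brownian_web P W)
  (dual_What : dual_brownian_web P W What)
  (Z_starts : forall z : R * R,
     {ae P, forall w, exists2 q, compact_set (Z w) q & starts_at q z})
  (Z_not_crossing : {ae P, forall w,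
     ~ exists p q, [/\ compact_set (W w) p, compact_set (Z w) q & crosses p q]})
  (Z_not_coinciding : {ae P, forall w, forall p q,
     compact_set (W w) p -> compact_set (Z w) q ->
     ~ coincide_on_interval p q}) :
  {ae P, forall w, Z w = What w}.
Proof.
have [Y hY] := web_values web_W.
have mY z t : z.2 <= t -> measurable_fun setT (Y z t) by case: (hY z) => + _ _; apply.
have vY z : {ae P, forall w, forall p, compact_set (W w) p -> starts_at p z ->
    forall t, z.2 <= t -> pos p t = (Y z t w)%:E} by case: (hY z).
have aY z t x : z.2 < t -> {ae P, forall w, Y z t w <> x} by case: (hY z) => _ _; apply.
have gW := good_web_ae web_W vY.
have gZ := good_dual_ae web_W mY vY aY Z_starts Z_not_crossing Z_not_coinciding.
have [_ dual] := dual_What; move: gW gZ dual; apply: filterS3 => w gW gZ dual.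
by apply: compacts_eq; rewrite dual; exact: good_dual_avoids_wedges.
Qed.
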